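(* Let $d\geq5$ and $r$ be integers with $d/3<r<d/2$ and $\gcd(r,d)=1$, and let $\alpha=r/d$. Then for each prime $p\equiv1\pmod d$, $$\sum_{k=0}^{p-1}\frac{(\alpha)_k^5(1+\frac12\alpha)_k(1-2\alpha)_k}{(k!)^5(\frac12\alpha)_k(3\alpha)_k}\equiv\frac{(-1)^{\frac{p-1}{d}}}{3\alpha-1}\cdot\frac{\Gamma_p(\alpha)^5\Gamma_p(3\alpha)}{\Gamma_p(2\alpha)^4}\pmod{p^5}.$$
   Context: $(x)_k=x(x+1)\cdots(x+k-1)$, $(x)_0=1$. $\Gamma_p$ is Morita's $p$-adic Gamma function: $\Gamma_p(0)=1$, $\Gamma_p(n)=(-1)^n\prod_{1\leq k<n,\ p\nmid k}k$ for integers $n\geq1$, extended continuously to $\mathbb{Z}_p$; rationals with denominator prime to $p$ are viewed in $\mathbb{Z}_p$. *)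

(* Defs.v *)
From HB Require Import structures.
From mathcomp Require Import all_boot all_order all_algebra.
From mathcomp Require Import boolp classical_sets.

Set Implicit Arguments.
Unset Strict Implicit.
Unset Printing Implicit Defensive.

Import Order.TTheory GRing.Theory Num.Theory.

Local Open Scope ring_scope.

Definition rising (R : pzRingType) (x : R) (k : nat) : R :=
  \prod_(0 <= i < k) (x + i%:R).

(* Z_p as the inverse limit of the rings Z/p^n.  The n-th component is the
   representative in [0, p^n): the coherence condition forces this range. *)
Record padic_int (p : nat) (p_pr : prime p) := PadicInt {
  residue :> nat -> int;
  residueP : forall n, residue n = (residue n.+1 %% p%:Z ^+ n)%Z }.

Section PadicInt.

Variables (p : nat) (p_pr : prime p).
Local Notation Zp := (padic_int p_pr).
Local Notation q n := (p%:Z ^+ n).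
Implicit Types (x y z : Zp) (u v : nat -> int).

HB.instance Definition _ := gen_eqMixin Zp.
HB.instance Definition _ := gen_choiceMixin Zp.

Lemma pexpz n : q n = (p ^ n)%N.
Proof. by elim: n => // n IH; rewrite exprS IH expnS PoszM. Qed.

Lemma padic_intP x y : (forall n, x n = y n) -> x = y.
Proof.
case: x y => [u Pu] [v Pv] /= /funext uv; subst v.
by rewrite (Prop_irrelevance Pu Pv).
Qed.

Lemma residue_mod x n : (x n %% q n)%Z = x n.
Proof. by rewrite residueP modz_mod. Qed.

Lemma eqmodz_trunc (a b : int) m n : (m <= n)%N ->
  (a = b %[mod q n])%Z -> (a = b %[mod q m])%Z.
Proof.
move=> mn /eqP; rewrite eqz_mod_dvd => h; apply/eqP; rewrite eqz_mod_dvd.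
by apply: dvdz_trans h; rewrite -(subnK mn) exprD dvdz_mull.
Qed.

Lemma residue_le x m n : (m <= n)%N -> (x n %% q m)%Z = x m.
Proof.
move=> mn; rewrite -(subnK mn); elim: (n - m)%N => [|k IH].
  by rewrite add0n residue_mod.
rewrite -[RHS]IH addSn [in RHS]residueP.
by apply: (eqmodz_trunc (leq_addl k m)); rewrite modz_mod.
Qed.

Definition coherent u := forall n, (u n = u n.+1 %[mod q n])%Z.

Fact mkpadic_subproof u (cu : coherent u) n :
  (u n %% q n)%Z = ((u n.+1 %% q n.+1)%Z %% q n)%Z.
Proof.
by rewrite cu; apply: (eqmodz_trunc (leqnSn n)); rewrite modz_mod.
Qed.

Definition mkpadic u (cu : coherent u) : Zp :=
  PadicInt p_pr (mkpadic_subproof cu).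

Fact padic_const_subproof (k : int) : coherent (fun=> k). Proof. by []. Qed.
Definition padic_const k := mkpadic (padic_const_subproof k).

Fact padic_add_subproof x y : coherent (fun n => x n + y n).
Proof. by move=> n; rewrite [x n]residueP [y n]residueP modzDm. Qed.
Definition padic_add x y := mkpadic (padic_add_subproof x y).

Fact padic_opp_subproof x : coherent (fun n => - x n).
Proof. by move=> n; rewrite [x n]residueP modzNm. Qed.
Definition padic_opp x := mkpadic (padic_opp_subproof x).

Fact padic_mul_subproof x y : coherent (fun n => x n * y n).
Proof. by move=> n; rewrite [x n]residueP [y n]residueP modzMm. Qed.
Definition padic_mul x y := mkpadic (padic_mul_subproof x y).

Fact padic_addA : associative padic_add.
Proof. by move=> x y z; apply: padic_intP => n /=; rewrite modzDmr modzDml addrA. Qed.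
Fact padic_addC : commutative padic_add.
Proof. by move=> x y; apply: padic_intP => n /=; rewrite addrC. Qed.
Fact padic_add0 : left_id (padic_const 0) padic_add.
Proof. by move=> x; apply: padic_intP => n /=; rewrite modzDml add0r residue_mod. Qed.
Fact padic_addN : left_inverse (padic_const 0) padic_opp padic_add.
Proof. by move=> x; apply: padic_intP => n /=; rewrite modzDml addNr. Qed.
Fact padic_mulA : associative padic_mul.
Proof. by move=> x y z; apply: padic_intP => n /=; rewrite modzMmr modzMml mulrA. Qed.
Fact padic_mulC : commutative padic_mul.
Proof. by move=> x y; apply: padic_intP => n /=; rewrite mulrC. Qed.
Fact padic_mul1 : left_id (padic_const 1) padic_mul.
Proof. by move=> x; apply: padic_intP => n /=; rewrite modzMml mul1r residue_mod. Qed.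
Fact padic_mulDl : left_distributive padic_mul padic_add.
Proof.
by move=> x y z; apply: padic_intP => n /=; rewrite modzMml modzDm mulrDl.
Qed.
Fact padic_1neq0 : padic_const 1 != padic_const 0.
Proof.
apply/eqP => /(congr1 (fun x : Zp => x 1%N)) /= /eqP.
rewrite expr1 eqz_mod_dvd subr0 dvdzE /= dvdn1 => /eqP p1.
by move: p_pr; rewrite p1.
Qed.

HB.instance Definition _ := GRing.isZmodule.Build Zp
  padic_addA padic_addC padic_add0 padic_addN.
HB.instance Definition _ := GRing.Zmodule_isComNzRing.Build Zp
  padic_mulA padic_mulC padic_mul1 padic_mulDl padic_1neq0.

Definition padic_unit : pred Zp := fun x => `[< exists y, y * x = 1 >].

Definition padic_inv x : Zp :=
  if pselect (exists y, y * x = 1) is left h then sval (cid h) else x.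

Fact padic_mulV : {in padic_unit, left_inverse 1 padic_inv *%R}.
Proof.
move=> x /asboolP xu; rewrite /padic_inv; case: pselect => // h.
by case: (cid h).
Qed.
Fact padic_unitP x y : y * x = 1 -> padic_unit x.
Proof. by move=> yx; apply/asboolP; exists y. Qed.
Fact padic_inv_out : {in [predC padic_unit], padic_inv =1 id}.
Proof. by move=> x /asboolP xu; rewrite /padic_inv; case: pselect. Qed.

HB.instance Definition _ := GRing.ComNzRing_hasMulInverse.Build Zp
  padic_mulV padic_unitP padic_inv_out.

Lemma residueD x y n : (x + y) n = ((x n + y n) %% q n)%Z. Proof. by []. Qed.
Lemma residueM x y n : (x * y) n = ((x n * y n) %% q n)%Z. Proof. by []. Qed.
Lemma residueN x n : (- x) n = ((- x n) %% q n)%Z. Proof. by []. Qed.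

Lemma residue_natr (k n : nat) : (k%:R : Zp) n = (k%:Z %% q n)%Z.
Proof.
elim: k => [|k IH] //.
by rewrite -addn1 natrD residueD IH modzDm PoszD.
Qed.

Lemma residue_intr (k : int) n : (k%:~R : Zp) n = (k %% q n)%Z.
Proof.
case: k => k; first exact: residue_natr.
by rewrite NegzE mulrNz residueN residue_natr modzNm.
Qed.

Lemma residue_ge0 x n : 0 <= x n.
Proof.
by rewrite -residue_mod modz_ge0 // expf_neq0 // -lt0n prime_gt0.
Qed.

Fact padic_integral x y : x * y = 0 -> (x == 0) || (y == 0).
Proof.
move=> xy0; apply/norP; case=> /eqP x0 /eqP y0.
have nz z : z <> 0 -> exists n, z n <> 0.
  move=> z0; apply/not_existsP => h; apply: z0; apply: padic_intP => n.
  by rewrite (residue_natr 0) mod0z; apply: contrapT => /h.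
have [a xa] := nz _ x0; have [b yb] := nz _ y0.
pose n := (a + b)%N.
have val z c : (c <= n)%N -> z c <> 0 ->
    exists2 m : nat, z n = m & (0 < m)%N && (logn p m < c)%N.
  move=> cn zc; have := residue_ge0 z n.
  case: (z n) (residue_le z cn) => // m zm _; exists m => //.
  have ndvd : ~~ (p ^ c %| m)%N.
    apply/negP => h; apply: zc; rewrite -zm; apply/eqP.
    by rewrite pexpz modz_nat; move: h => /eqP ->.
  have m0 : (0 < m)%N by case: (m) ndvd => //; rewrite dvdn0.
  by rewrite m0 ltnNge -pfactor_dvdn.
have [k xk /andP[k0 ka]] := val x a (leq_addr _ _) xa.
have [l yl /andP[l0 lb]] := val y b (leq_addl _ _) yb.
have : (x * y) n = 0 by rewrite xy0 (residue_natr 0) mod0z.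
rewrite residueM xk yl -PoszM.
rewrite pexpz modz_nat => -[] /eqP; rewrite -/(dvdn _ _) pfactor_dvdn ?muln_gt0 ?k0 //.
by rewrite lognM // leqNgt (leq_trans _ (leq_add ka (ltnW lb))).
Qed.

HB.instance Definition _ := GRing.ComUnitRing_isIntegral.Build Zp padic_integral.

Lemma padic_intr_unit (k : int) :
  coprime p `|k|%N -> (k%:~R : Zp) \is a GRing.unit.
Proof.
move=> cpk.
have cop n : coprimez (q n) k.
  by rewrite pexpz coprimezE /= coprimeXl.
pose u n := (egcdz k (q n)).1.
have uk n : (u n * k = 1 %[mod q n])%Z.
  rewrite /u; case: egcdzP => a b e _ /=; move: e.
  have := cop n; rewrite coprimez_sym => /eqP -> <-.
  by rewrite addrC modzMDl.
have cu : coherent u.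
  move=> n; apply/eqP; rewrite eqz_mod_dvd -(Gauss_dvdzl _ (cop n)) mulrBl.
  rewrite -eqz_mod_dvd uk; apply/eqP; symmetry.
  exact: eqmodz_trunc (leqnSn n) (uk n.+1).
apply/unitrP; exists (mkpadic cu); rewrite mulrC; split=> //;
 rewrite mulrC; apply: padic_intP => n.
all: by rewrite residueM residue_intr /= modzMm uk; apply/esym/(residue_natr 1).
Qed.

Lemma padic_int_natr_eq0 (k : nat) : ((k%:R : Zp) == 0) = (k == 0%N).
Proof.
apply/eqP/eqP => [k0|-> //]; have := residue_natr k k.
rewrite k0 (residue_natr 0) mod0z pexpz modz_nat modn_small => [[] // |].
by rewrite ltn_expl ?prime_gt1.
Qed.

End PadicInt.

Definition padic (p : nat) (p_pr : prime p) := {fraction padic_int p_pr}.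
HB.instance Definition _ (p : nat) (p_pr : prime p) :=
  GRing.Field.on (padic p_pr).

Definition padic_of_int (p : nat) (p_pr : prime p) (x : padic_int p_pr) :
  padic p_pr := tofrac x.

Lemma padic_natr_eq0 (p : nat) (p_pr : prime p) (k : nat) :
  ((k%:R : padic p_pr) == 0) = (k == 0%N).
Proof.
rewrite -(padic_int_natr_eq0 p_pr) -(rmorph_nat (@FracField.tofrac (padic_int p_pr))).
exact: tofrac_eq0.
Qed.

(* x = y (mod p^n) in Q_p, i.e. x - y lies in p^n Z_p. *)
Definition padic_eqmod (p : nat) (p_pr : prime p) (n : nat)
    (x y : padic p_pr) : Prop :=
  exists z : padic_int p_pr, x - y = p%:R ^+ n * padic_of_int z.

(* Two p-adic integers agree at level n iff they are congruent modulo p^n, so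
   this is continuity for the p-adic topology. *)
Definition padic_continuous (p : nat) (p_pr : prime p)
    (f : padic_int p_pr -> padic_int p_pr) : Prop :=
  forall (x : padic_int p_pr) (n : nat), exists m : nat,
    forall y : padic_int p_pr, y m = x m -> f y n = f x n.

(* At n = 0 the product is empty and the value is 1. *)
Definition Gamma_nat (p n : nat) : int :=
  (-1) ^+ n * \prod_(1 <= k < n | ~~ (p %| k)%N) k%:Z.

Definition is_Morita_Gamma (p : nat) (p_pr : prime p)
    (G : padic_int p_pr -> padic_int p_pr) : Prop :=
  padic_continuous G /\ forall n : nat, G n%:R = (Gamma_nat p n)%:~R.

(* For odd p the set is a singleton: see is_Morita_Gamma_unique and
   padic_GammaP below. *)
Definition padic_Gamma (p : nat) (p_pr : prime p) :
    padic_int p_pr -> padic_int p_pr :=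
  xget (fun=> 0) [set G | is_Morita_Gamma G]%classic.

Section MoritaGamma.

Variables (p : nat) (p_pr : prime p).
Local Notation Zp := (padic_int p_pr).

Lemma is_Morita_Gamma_unique (G H : Zp -> Zp) :
  is_Morita_Gamma G -> is_Morita_Gamma H -> G = H.
Proof.
move=> [cG GN] [cH HN]; apply/funext => x; apply: padic_intP => n.
have [a Ga] := cG x n; have [b Hb] := cH x n.
pose m := maxn a b; pose k := `|x m|%N.
have kx c : (c <= m)%N -> (k%:R : Zp) c = x c.
  by move=> cm; rewrite residue_natr gez0_abs ?residue_ge0 // residue_le.
rewrite -(Ga _ (kx a (leq_maxl _ _))) -(Hb _ (kx b (leq_maxr _ _))).
by rewrite GN HN.
Qed.

End MoritaGamma.

(* Existence rests on Gamma_nat p (m + p^n) = Gamma_nat p m (mod p^n), which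
   follows from Wilson's theorem modulo p^n. *)
Section Wilson.
Variables (p n : nat).
Hypotheses (p_pr : prime p) (p_odd : odd p).
Local Notation N := (p ^ n.+1)%N.
Local Notation R := 'Z_N.

Let N_gt1 : (1 < N)%N.
Proof. by rewrite (leq_trans (prime_gt1 p_pr)) // expnS leq_pmulr // expn_gt0 prime_gt0. Qed.

Let coprimeN k : coprime N k = ~~ (p %| k)%N.
Proof. by rewrite coprime_pexpl // prime_coprime. Qed.

Let dvN (a : nat) : (a%:R == 0 :> R) = (N %| a)%N.
Proof. by rewrite -val_eqE /= val_Zp_nat. Qed.

Lemma Zp_sqr1 (x : R) : x * x = 1 -> x = 1 \/ x = -1.
Proof.
move=> xx; pose k : nat := val x.
have xk : x = k%:R by rewrite natr_Zp.
have k0 : (0 < k)%N.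
  rewrite lt0n; apply/eqP => k0; move: xx; rewrite xk k0 mul0r => /eqP.
  by rewrite eq_sym oner_eq0.
have : (N %| k.-1 * k.+1)%N.
  rewrite -dvN natrM -(prednK k0) in xk *; set j := k.-1 in xk *.
  rewrite /= -[j.+2%:R]natr1 -xk; have -> : j%:R = x - 1 :> R.
    by rewrite xk -natr1 addrK.
  by rewrite mulrDr mulr1 mulrBl xx mul1r addrA subrK subrr.
case: (boolP (p %| k.-1)%N) => pk.
  have pk' : ~~ (p %| k.+1)%N.
    apply/negP => pk'; have : (p %| k.+1 - k.-1)%N by rewrite dvdn_sub.
    rewrite -[in k.+1](prednK k0) -addn2 addKn => /(@dvdn_leq p 2 isT).
    by rewrite leqNgt odd_prime_gt2.
  rewrite Gauss_dvdl ?coprimeN // -dvN => /eqP k1; left.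
  by rewrite xk -(prednK k0) -natr1 k1 add0r.
rewrite Gauss_dvdr ?coprimeN // -dvN -natr1 -xk => /eqP/eqP.
by rewrite addr_eq0 => /eqP ->; right.
Qed.

Lemma Zp_unit_prod : \prod_(x : R | x \is a GRing.unit) x = -1.
Proof.
have two : (1 : R) != -1.
  rewrite -addr_eq0 -(natrD _ 1 1) dvN; apply/negP => dv.
  have : (p %| 2)%N by apply: dvdn_trans dv; rewrite expnS dvdn_mulr.
  by move/(@dvdn_leq p 2 isT); rewrite leqNgt odd_prime_gt2.
rewrite (bigID (fun x : R => x * x == 1)) /=.
have -> : \prod_(x : R | (x \is a GRing.unit) && (x * x == 1)) x = -1.
  rewrite (bigD1 1) /= ?unitr1 ?mulr1 ?eqxx // mul1r.
  rewrite (bigD1 (-1)) /= ?unitrN1 ?mulrNN ?mulr1 ?eqxx 1?eq_sym ?two //.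
  rewrite big1 ?mulr1 // => x /andP[/andP[/andP[_ /eqP xx] x1] x2].
  by case: (Zp_sqr1 xx) x1 x2 => ->; rewrite eqxx.
rewrite (bigID (fun x : R => (val x < val x^-1)%N)) /=.
set A := \prod_(x | _ && (_ < _)%N) _; set B := \prod_(x | _) _.
suff -> : B = \prod_(x : R | (x \is a GRing.unit) && (x * x != 1)
                        && (val x < val x^-1)%N) x^-1.
  rewrite /A -big_split /= big1 ?mulr1 // => x /andP[/andP[xu _] _].
  exact: divrr.
rewrite /B (reindex_inj (can_inj (@invrK R))) /=.
apply: eq_bigl => x; rewrite unitrV invrK -leqNgt.
case xu: (x \is a GRing.unit) => //=.
have e : (x^-1 * x^-1 == 1) = (x * x == 1).
  rewrite -invrM // -[RHS](inj_eq (@invr_inj R)) invr1 //.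
rewrite e; case: eqP => //= xx; rewrite leq_eqVlt.
case: eqP => //= /val_inj xV; case: xx; rewrite [in X in X * _]xV mulVr //.
Qed.

Let F (k : nat) : R := if ~~ (p %| k)%N then k%:R else 1.

Let FN k : F (k + N) = F k.
Proof.
rewrite /F dvdn_addl ?expnS ?dvdn_mulr // -expnS natrD.
have -> : N%:R = 0 :> R by exact: pchar_Zp.
by rewrite addr0.
Qed.

Let prodF m : \prod_(m <= k < m + N) F k = -1.
Proof.
elim: m => [|m IH].
  have aux M : N = M -> \prod_(0 <= k < N) F k = \prod_(k < M) F k.
    by move=> <-; rewrite big_mkord.
  rewrite add0n -Zp_unit_prod (aux _ (esym (Zp_cast N_gt1))) [RHS]big_mkcond.
  apply: eq_bigr => x _.
  by rewrite /F -coprimeN -unitZpE // natr_Zp.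
have lt : (m < m + N)%N by rewrite -[X in (X < _)%N]addn0 ltn_add2l ltnW.
rewrite addSn big_nat_recr //= FN -IH mulrC.
by rewrite [RHS]big_ltn.
Qed.

Let Gamma_modE m :
  (Gamma_nat p m)%:~R = (-1) ^+ m * \prod_(0 <= k < m) F k :> R.
Proof.
rewrite /Gamma_nat rmorphM rmorphXn rmorphN1 rmorph_prod; congr (_ * _).
case: m => [|m]; first by rewrite !big_geq.
rewrite [RHS]big_ltn // {1}/F dvdn0 mul1r big_mkcond /=.
by apply: eq_bigr => k _; rewrite /F.
Qed.

Let Gamma_modDN m :
  (Gamma_nat p (m + N))%:~R = (Gamma_nat p m)%:~R :> R.
Proof.
rewrite !Gamma_modE (@big_cat_nat _ _ _ m) ?leq_addr //= prodF.
rewrite exprD -(signr_odd _ N) oddX p_odd orbT expr1.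
by rewrite !mulrN1 mulrNN.
Qed.

Let intr_eq_mod (a b : int) : a%:~R = b%:~R :> R -> (a = b %[mod N%:Z])%Z.
Proof.
move/eqP; rewrite -subr_eq0 -rmorphB => h; apply/eqP; rewrite eqz_mod_dvd.
rewrite dvdzE; case: (a - b)%R h => c.
  by rewrite dvN.
by rewrite NegzE rmorphN oppr_eq0 dvN.
Qed.

Lemma Gamma_nat_mod (a b : nat) :
  (a = b %[mod N])%N -> (Gamma_nat p a = Gamma_nat p b %[mod p%:Z ^+ n.+1])%Z.
Proof.
have red c : (Gamma_nat p c)%:~R = (Gamma_nat p (c %% N))%:~R :> R.
  rewrite {1}(divn_eq c N); elim: (c %/ N)%N => [|k IH]; first by rewrite mul0n.
  by rewrite mulSn -addnA addnC Gamma_modDN.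
by move=> ab; rewrite pexpz; apply: intr_eq_mod; rewrite red ab -red.
Qed.

End Wilson.

Lemma padic_GammaP (p : nat) (p_pr : prime p) (p_odd : odd p) :
  is_Morita_Gamma (@padic_Gamma p p_pr).
Proof.
rewrite /padic_Gamma; apply: xgetPex.
have gmod (n : nat) (a b : int) : 0 <= a -> 0 <= b ->
    (a = b %[mod p%:Z ^+ n])%Z ->
    (Gamma_nat p `|a| = Gamma_nat p `|b| %[mod p%:Z ^+ n])%Z.
  case: n => [|n]; first by rewrite !modz1.
  case: a b => // a [] // b _ _; rewrite pexpz !modz_nat => -[ab].
  by rewrite -pexpz; exact: Gamma_nat_mod.
have cu (x : padic_int p_pr) : coherent p (fun n => Gamma_nat p `|x n|).
  move=> n; apply: gmod; rewrite ?residue_ge0 //.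
  by rewrite residue_mod [LHS]residueP.
exists (fun x => mkpadic p_pr (cu x)); split=> [x n|m].
  by exists n => y /= ->.
apply: padic_intP => n; rewrite residue_intr /=.
rewrite -[m in RHS]absz_nat; apply: gmod; rewrite ?residue_ge0 //.
by rewrite residue_natr modz_mod.
Qed.

(* Main.v *)
Require Import Defs.
From mathcomp Require Import all_boot all_order all_algebra.
From mathcomp Require Import all_field.
From mathcomp Require Import boolp.
From mathcomp Require Import ring zify.
Import Order.TTheory GRing.Theory Num.Theory.
Local Open Scope ring_scope.

Set Implicit Arguments.
Unset Strict Implicit.
Unset Printing Implicit Defensive.

(** The series is Dougall's very-well-poised 2-balanced 7F6 at the parameters
    [a = b_1 = ... = b_4 = alpha], [b_5 = 1 - 2 alpha].  Put [N = r (p - 1) / d]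
    and [M = p - 1 - 2 N], so that [alpha] is [- N] and [b_5] is [- M] modulo [p].
    Move the parameters along an affine line with [b_i = - N] at [u = i] for
    [i = 1, .., 4] and [b_5 = - M] at [u = 5], every increment being divisible by
    [p]; the balancing condition then fixes [a].  For [a = - N] the sum truncated
    at [N] vanishes by antisymmetry, so it is divisible by [a + N]; the quotient,
    freed of the one factor of the denominators that is divisible by [p], is a
    function [Q] of [u] whose [k]-th differences are divisible by [p ^ k], and so
    is the corresponding symmetric product [R] of values of [Gamma_p].  Dougall's
    theorem gives [Q = R] at [u = 1, .., 5], hence [Q = R] modulo [p ^ 5] at
    [u = 0]. *)

(** * Dougall's summation *)

(** The obstacle is a single power of [p]. The denominator [(3 alpha)_k] may contain one multiple of
    [p], so interpolating the cleared sum itself modulo [p ^ 5] would give the series only modulo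
    [p ^ 4]. Interpolating its quotient by [a + N] keeps all five powers: at [u = 0] this factor is
    [p alpha], and its [p] cancels the one below. Truncating at [N] costs nothing: at each
    interpolation point the sum ends by itself, and each later term of the original series has six
    factors [p] above (five from [(alpha)_k ^ 5], one from [(1 - 2 alpha)_k]) and at most one below.

    Since [Gamma_p] is not a polynomial, the interpolation uses finite differences in place of
    coefficients. Each of the five [b_i] supplies one point, and this number of points is the
    exponent of the modulus. Along the line all parameters keep their residues modulo [p], so the
    factors divisible by [p] stay at the same places and the divisions in [Q] and [R] are by
    units. *)

Section Rising.
Variable R : comNzRingType.
Implicit Types (x s a b c d e : R) (k m n : nat).

Lemma rising0 x : rising x 0 = 1.
Proof. by rewrite /rising big_geq. Qed.

Lemma risingS x k : rising x k.+1 = rising x k * (x + k%:R).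
Proof. by rewrite /rising big_nat_recr. Qed.

Lemma rising_cat x m n :
  rising x (m + n) = rising x m * rising (x + m%:R) n.
Proof.
elim: n => [|n IH]; first by rewrite addn0 rising0 mulr1.
by rewrite addnS !risingS IH natrD mulrA addrA.
Qed.

Lemma risingSl x k : rising x k.+1 = x * rising (x + 1) k.
Proof. by rewrite -add1n rising_cat risingS rising0 mul1r addr0. Qed.

Lemma rising_reflect x n :
  rising (1 - n%:R - x) n = (-1) ^+ n * rising x n.
Proof.
elim: n => [|n IH]; first by rewrite !rising0 mulr1.
rewrite risingSl risingS exprS -natr1.
have -> : 1 - (n%:R + 1) - x + 1 = 1 - n%:R - x by ring.
by rewrite IH; ring.
Qed.

Lemma rising_opp_nat n k : (n < k)%N -> rising (- n%:R : R) k = 0.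
Proof.
by move=> nk; rewrite -(subnKC nk) rising_cat risingS addNr mulr0 mul0r.
Qed.

Definition wellpoised a (gs : seq R) n : R :=
  \sum_(0 <= k < n.+1) (a + k%:R *+ 2) *
    \prod_(g <- gs) (rising g k * rising (1 + a - g + k%:R) (n - k)).

(** The balancing condition ties [e] to [n], so passing to [n.+1] raises [e] to [e + 1]. The spare
    factor [e] on both sides turns [rising (e + 1) k] into [rising e k * (e + k)] without a
    division. *)
Lemma dougall_step a b c d e n : e = 1 + a *+ 2 - b - c - d + n%:R ->
  e * wellpoised a [:: a; b; c; d; e + 1; - n.+1%:R] n.+1 =
  e * (- (n.+1%:R * (a + (n.*2.+1)%:R) * (a + (n.*2.+2)%:R) *
       ((1 + a - b - c + n%:R) * (1 + a - b - d + n%:R) * (1 + a - c - d + n%:R))) *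
    wellpoised a [:: a; b; c; d; e; - n%:R] n).
Proof.
move=> he.
(* Gosper's certificate: the summands of the two sides differ by
   [h k - h k.+1]. *)
pose h k : R := (n.+1%:R + e) * (rising k%:R (n.+1 - k) * rising a k) *
  ((rising b k * rising (a - b + k%:R) (n.+1 - k)) *
   (rising c k * rising (a - c + k%:R) (n.+1 - k)) *
   (rising d k * rising (a - d + k%:R) (n.+1 - k)) *
   (rising e k * rising (a - e + k%:R) (n.+1 - k))) *
  (rising (- n.+1%:R) k * rising (1 + a + n%:R + k%:R) (n.+2 - k)).
pose U k : R := e * ((a + k%:R *+ 2) * \prod_(g <- [:: a; b; c; d; e + 1; - n.+1%:R])
   (rising g k * rising (1 + a - g + k%:R) (n.+1 - k))).
pose V k : R := (a + k%:R *+ 2) * \prod_(g <- [:: a; b; c; d; e; - n%:R])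
   (rising g k * rising (1 + a - g + k%:R) (n - k)).
pose rho := (n.+1%:R * (a + (n.*2.+1)%:R) * (a + (n.*2.+2)%:R) *
       ((1 + a - b - c + n%:R) * (1 + a - b - d + n%:R) * (1 + a - c - d + n%:R))).
have step k : (k <= n)%N -> U k + e * rho * V k = h k - h k.+1.
  move=> kn; rewrite /U /V /h /rho !big_cons !big_nil.
  have -> : (n.+2 - k = (n - k).+2)%N by lia.
  have -> : (n.+1 - k = (n - k).+1)%N by lia.
  have -> : (n.+1 - k.+1 = n - k)%N by lia.
  have -> : (n.+2 - k.+1 = (n - k).+1)%N by lia.
  have ee : e * rising (e + 1) k = rising e k * (e + k%:R).
    by rewrite -risingSl risingS.
  have nn : n.+1%:R * rising (- n%:R) k = rising (- n.+1%:R) k * (n.+1%:R - k%:R) :> R.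
    have := risingS (- n.+1%:R) k; rewrite risingSl -natr1.
    have -> : - (n%:R + 1) + 1 = - n%:R :> R by ring.
    move=> E; have -> : (n%:R + 1) * rising (- n%:R) k = - (- (n%:R + 1) * rising (- n%:R) k) :> R by ring.
    by rewrite E; ring.
  have last x : rising x (n - k).+1 = rising x (n - k) * (x + n%:R - k%:R).
    by rewrite risingS natrB // addrA.
  pose w (x : R) := rising (1 + a - x + k%:R) (n - k).
  have top g : rising (1 + a - g + k%:R) (n - k).+1 = w g * (1 + a - g + n%:R).
    by rewrite last; congr (_ * _); ring.
  have bot g : rising (a - g + k%:R) (n - k).+1 = (a - g + k%:R) * w g.
    by rewrite risingSl /w; congr (_ * rising _ _); ring.
  have bot' g : rising (a - g + k.+1%:R) (n - k) = w g.
    by rewrite /w -natr1; congr (rising _ _); ring.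
  set y := rising (1 + a - - n.+1%:R + k%:R) (n - k).+1.
  have y1 : rising (1 + a + n%:R + k.+1%:R) (n - k).+1 = y.
    by rewrite /y -!natr1; congr (rising _ _); ring.
  have y2 : rising (1 + a + n%:R + k%:R) (n - k).+2 = (1 + a + n%:R + k%:R) * y.
    by rewrite risingSl /y -!natr1; congr (_ * rising _ _); ring.
  have y3 : w (- n%:R) * ((a + n.*2.+1%:R) * (a + n.*2.+2%:R)) = (1 + a + n%:R + k%:R) * y.
    rewrite -y2 risingS risingS /w opprK.
    have -> : 1 + a + n%:R + k%:R + (n - k)%:R = a + n.*2.+1%:R.
      by rewrite natrB // -addnn -natr1 natrD; ring.
    have -> : 1 + a + n%:R + k%:R + (n - k).+1%:R = a + n.*2.+2%:R.
      by rewrite -natr1 natrB // -addnn -!natr1 natrD; ring.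
    by ring.
  have e1 : rising (1 + a - (e + 1) + k%:R) (n - k).+1 = (a - e + k%:R) * w e.
    by rewrite -bot; congr (rising _ _); ring.
  have z1 : rising (1 + a - a + k%:R) (n - k).+1 = w a * (1 + n%:R).
    by rewrite top; congr (_ * _); ring.
  have z2 : rising k%:R (n - k).+1 = k%:R * w a.
    by rewrite risingSl /w; congr (_ * rising _ _); ring.
  have z3 : rising k.+1%:R (n - k) = w a.
    by rewrite /w -natr1; congr (rising _ _); ring.
  rewrite e1 z1 z2 z3 !top !bot !bot' y1 y2 !risingS -/(w a) -/(w b) -/(w c) -/(w d) -/(w e) -/(w (- n%:R)).
  set ra := rising a k; set rb := rising b k; set rc := rising c k; set rd := rising d k.
  set re := rising e k; set rm := rising (- n.+1%:R) k.
  set wa := w a; set wb := w b; set wc := w c; set wd := w d; set we := w e.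
  set re' := rising (e + 1) k in ee *; set rn := rising (- n%:R) k in nn *.
  set wn := w (- n%:R) in y3 *.
  set B := (1 + a - b - c + n%:R) * _ * _.
  transitivity (ra * rb * rc * rd * rm * (wa * wb * wc * wd * we * y) * re * (a + k%:R *+ 2) *
    ((1 + a - b + n%:R) * (1 + a - c + n%:R) * (1 + a - d + n%:R) * (1 + n%:R) * (e + k%:R) * (a - e + k%:R) 
    + e * B * (n.+1%:R - k%:R) * (1 + a + n%:R + k%:R))).
    transitivity ((a + k%:R *+ 2) * (ra * rb * rc * rd * (wa * wb * wc * wd * we)) *
      ((1 + a - b + n%:R) * (1 + a - c + n%:R) * (1 + a - d + n%:R) * (1 + n%:R) * (e * re') * (a - e + k%:R) * rm * y
      + e * B * re * (n.+1%:R * rn) * (wn * ((a + n.*2.+1%:R) * (a + n.*2.+2%:R))))).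
      by ring.
    by rewrite ee nn y3 -/re -/rm; ring.
  (* With the common products split off, a polynomial identity is left; the balancing condition
     enters here. *)
  rewrite /B -!natr1.
  move: (n%:R : R) (k%:R : R) he => N K he.
  transitivity (ra * rb * rc * rd * rm * (wa * wb * wc * wd * we * y) * re *
    ((N + 1 + e) * ((a + K) * (b + K) * (c + K) * (d + K) * (e + K) * (N + 1 - K)
     + K * (a - b + K) * (a - c + K) * (a - d + K) * (a - e + K) * (1 + a + N + K)))).
    by rewrite -[LHS]mulrA; congr (_ * _); rewrite he; ring.
  by ring.
(* The left sum has one term more than the right one. It closes the telescope: the total is [h 0],
   which vanishes through [rising 0 n.+1]. *)
have last : U n.+1 = h n.+1.
  rewrite /U /h !big_cons !big_nil !subnn !rising0.
  have -> : (n.+2 - n.+1 = 1)%N by lia.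
  have ee : e * rising (e + 1) n.+1 = rising e n.+1 * (e + n.+1%:R).
    by rewrite -risingSl risingS.
  rewrite !(risingS _ 0) !rising0.
  transitivity ((a + n.+1%:R *+ 2) * (rising a n.+1 * rising b n.+1 * rising c n.+1 * rising d n.+1 * rising (- n.+1%:R) n.+1) * (e * rising (e + 1) n.+1)).
    by ring.
  by rewrite ee -natr1; ring.
have h0 : h 0%N = 0 by rewrite /h risingSl !(mul0r, mulr0).
apply/eqP; rewrite mulNr mulrN -subr_eq0 opprK; apply/eqP.
rewrite /wellpoised big_nat_recr //= mulrDr -/(U n.+1) addrAC 3!mulr_sumr -big_split /=.
have tel m : \sum_(0 <= k < m) (h k - h k.+1) = h 0%N - h m.
  elim: m => [|m IH]; first by rewrite big_geq // subrr.
  by rewrite big_nat_recr //= IH; ring.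
transitivity (\sum_(0 <= k < n.+1) (h k - h k.+1) + U n.+1).
  congr (_ + _); apply: eq_big_nat => k /andP[_ kn].
  by rewrite -step // /V /U -/rho !mulrA.
by rewrite tel last h0 sub0r addNr.
Qed.
End Rising.

(** Dougall's product after clearing denominators: [a (1 + a)_n (1 + a + n)_n] is [(a)_(2n+1)], and
    by balancing [(1 + a - f)_n = (-1)^n (1 + a - b - c - d)_n] cancels the last classical
    denominator up to the sign. The second hypothesis lets the factor [e] of [dougall_step] be
    cancelled at each induction step. *)
Lemma dougall (R : idomainType) (a b c d f : R) (n : nat) :
  f = 1 + a *+ 2 - b - c - d + n%:R ->
  (forall j, (0 < j <= n)%N -> f - j%:R != 0) ->
  wellpoised a [:: a; b; c; d; f; - n%:R] n =
  (-1) ^+ n * n`!%:R * rising a n.*2.+1 *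
  (rising (1 + a - b - c) n * rising (1 + a - b - d) n * rising (1 + a - c - d) n).
Proof.
elim: n f => [|n IH] f hf nz.
  rewrite /wellpoised big_nat1 !big_cons big_nil !subnn double0 risingS !rising0.
  by rewrite fact0; ring.
have fe : f = f - 1 + 1 by rewrite subrK.
have he : f - 1 = 1 + a *+ 2 - b - c - d + n%:R by rewrite hf -natr1; ring.
have e0 : f - 1 != 0 by apply: (nz 1%N).
apply: (mulfI e0); rewrite {2}fe dougall_step // IH //; last first.
  move=> j /andP[j0 jn]; have := nz j.+1; rewrite -natr1 opprD addrA addrAC.
  by apply; rewrite ltnS.
by congr (_ * _); rewrite factS natrM doubleS exprS !risingS; ring.
Qed.

(** * Antisymmetry of well-poised sums *)

Section Congruence.
Variables (R : comNzRingType) (s : R).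

Definition eqmodr (x y : R) : Prop := exists z, x - y = s * z.

Lemma eqmodr_refl x : eqmodr x x.
Proof. by exists 0; rewrite subrr mulr0. Qed.

Lemma eqmodrD x y z t : eqmodr x y -> eqmodr z t -> eqmodr (x + z) (y + t).
Proof.
by move=> [u e] [v e']; exists (u + v); rewrite mulrDr -e -e'; ring.
Qed.

Lemma eqmodrM x y z t : eqmodr x y -> eqmodr z t -> eqmodr (x * z) (y * t).
Proof.
move=> [u e] [v e']; exists (u * z + v * y).
by rewrite mulrDr !mulrA -e -e'; ring.
Qed.

Lemma eqmodr_rising x y k : eqmodr x y -> eqmodr (rising x k) (rising y k).
Proof.
move=> xy; apply: (big_ind2 eqmodr) => //; first exact: eqmodr_refl.
- by move=> *; apply: eqmodrM.
- by move=> i _; apply: eqmodrD => //; apply: eqmodr_refl.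
Qed.

(* Modulo [s] one has [a = -n], and the summand is antisymmetric under
   [k |-> n - k]. *)
Lemma wellpoised_dvd (gs : seq R) (n : nat) : ~~ odd (size gs) ->
  exists z, wellpoised (s - n%:R) gs n *+ 2 = s * z.
Proof.
move=> even_gs; rewrite /wellpoised.
pose F k : R := (s - n%:R + k%:R *+ 2) *
  \prod_(g <- gs) (rising g k * rising (1 + (s - n%:R) - g + k%:R) (n - k)).
pose W k : R := \prod_(g <- gs) (rising g k * rising g (n - k)).
have sa x : eqmodr (s - n%:R + x) (- n%:R + x).
  by exists 1; ring.
have FW k : (k <= n)%N -> eqmodr (F k) ((- n%:R + k%:R *+ 2) * W k).
  move=> kn; apply: eqmodrM => //.
  (* Every parameter brings the same sign from its reflection, and their number is even. *)
  have -> : W k = \prod_(g <- gs) (rising g k * ((-1) ^+ (n - k) * rising g (n - k))).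
    under [RHS]eq_bigr => g _ do rewrite mulrCA.
    rewrite big_split /= big_const_seq count_predT iter_mulr_1 -exprM.
    by rewrite -signr_odd oddM (negbTE even_gs) andbF mul1r.
  apply: (big_ind2 eqmodr) => //; first exact: eqmodr_refl.
  - by move=> *; apply: eqmodrM.
  move=> g _; apply: eqmodrM; first exact: eqmodr_refl.
  rewrite -rising_reflect; apply: eqmodr_rising; exists 1.
  by rewrite natrB //; ring.
have sym k : (k <= n)%N -> eqmodr (F k + F (n - k)%N) 0.
  move=> kn.
  have -> : 0 = (- n%:R + k%:R *+ 2) * W k + (- n%:R + (n - k)%:R *+ 2) * W (n - k)%N.
    have -> : W (n - k)%N = W k.
      by apply: eq_bigr => g _; rewrite mulrC subKn.
    by rewrite natrB //; ring.
  by apply: eqmodrD; apply: FW => //; rewrite leq_subr.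
suff : eqmodr (\sum_(0 <= k < n.+1) F k *+ 2) 0.
  by case=> z; rewrite subr0 sumrMnl => e; exists z.
(* Pairing [k] with [n - k] counts each term twice; doubling the sum avoids dividing by 2 in [R]. *)
have -> : \sum_(0 <= k < n.+1) F k *+ 2 = \sum_(0 <= k < n.+1) (F k + F (n - k)%N).
  rewrite sumrMnl mulr2n big_split /=; congr (_ + _).
  by rewrite big_nat_rev /=; apply: eq_big_nat => k _; rewrite add0n subSS.
rewrite big_nat; apply: (big_ind (eqmodr ^~ 0)) => //; first exact: eqmodr_refl.
by move=> x y hx hy; rewrite -[X in eqmodr _ X](addr0 0); apply: eqmodrD.
Qed.

End Congruence.

(** * Finite differences divisible by powers of [q] *)

Section Smooth.
Variables (R : comUnitRingType) (q : R).
Implicit Types (f g : nat -> R) (n u : nat).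

(* [smooth n f] says that the [k]-th difference of [f] is divisible by [q ^+ k]
   for [k <= n], as for [f u = F.[q * u]] with [F] a polynomial. *)
Fixpoint smooth n f : Prop :=
  if n is m.+1 then
    exists2 g, smooth m g & forall u, f u.+1 = f u + q * g u
  else True.

Lemma eq_smooth n f g : f =1 g -> smooth n f -> smooth n g.
Proof. by case: n => // n fg [h sh fh]; exists h => // u; rewrite -!fg. Qed.

Lemma smoothW n f : smooth n.+1 f -> smooth n f.
Proof. by elim: n f => // n IH f [g sg fg]; exists g => //; apply: IH. Qed.

Lemma smooth_const n c : smooth n (fun=> c).
Proof.
by elim: n c => // n IH c; exists (fun=> 0) => // u; rewrite mulr0 addr0.
Qed.

Lemma smoothS n f : smooth n f -> smooth n (fun u => f u.+1).
Proof.
elim: n f => // n IH f [g sg fg]; exists (fun u => g u.+1) => //; exact: IH.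
Qed.

Lemma smoothD n f g : smooth n f -> smooth n g -> smooth n (fun u => f u + g u).
Proof.
elim: n f g => // n IH f g [f' sf ff] [g' sg gg].
exists (fun u => f' u + g' u); first exact: IH.
by move=> u; rewrite ff gg mulrDr addrACA.
Qed.

Lemma smoothM n f g : smooth n f -> smooth n g -> smooth n (fun u => f u * g u).
Proof.
elim: n f g => // n IH f g sf sg; case: (sf) (sg) => [f' sf' ff] [g' sg' gg].
exists (fun u => f u.+1 * g' u + f' u * g u).
  apply: smoothD; apply: IH => //; last exact: smoothW.
  by apply/smoothW/smoothS.
by move=> u; rewrite gg ff; ring.
Qed.

Lemma smooth_prod n (I : Type) (r : seq I) (F : I -> nat -> R) :
  (forall i, smooth n (F i)) -> smooth n (fun u => \prod_(i <- r) F i u).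
Proof.
move=> sF; elim: r => [|i r IH].
  by apply: eq_smooth (smooth_const n 1) => u; rewrite big_nil.
by apply: eq_smooth (smoothM (sF i) IH) => u; rewrite big_cons.
Qed.

Lemma smooth_exp n f : smooth n (fun u => q ^+ n * f u).
Proof.
elim: n f => // n IH f; exists (fun u => q ^+ n * (f u.+1 - f u)) => // u.
by rewrite exprS; ring.
Qed.

Lemma smooth_lin n w : smooth n (fun u => q * (w * u%:R)).
Proof.
case: n => // n; exists (fun=> w); first exact: smooth_const.
by move=> u; rewrite -natr1; ring.
Qed.

Lemma smooth_horner n (F : {poly R}) : smooth n (fun u => F.[q * u%:R]).
Proof.
elim/poly_ind: F => [|F c IH].
  by apply: eq_smooth (smooth_const n 0) => u; rewrite horner0.
apply: (@eq_smooth n (fun u => F.[q * u%:R] * (q * (1 * u%:R)) + c)).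
  by move=> u; rewrite hornerMXaddC mul1r.
by apply: smoothD (smooth_const _ _); apply: smoothM => //; apply: smooth_lin.
Qed.

(** Only values modulo [q ^+ n] matter for order [n]: an arbitrary sequence of multiples of [q ^+ n]
    has all its differences divisible by [q ^+ n]. *)
Lemma smooth_eqmod n f g :
  (forall u, exists z, g u = f u + q ^+ n * z) -> smooth n f -> smooth n g.
Proof.
move=> /choice[z gz] sf.
by apply: eq_smooth (smoothD sf (smooth_exp n z)) => u; rewrite gz.
Qed.

Lemma smoothV n f : (forall u, f u \is a GRing.unit) ->
  smooth n f -> smooth n (fun u => (f u)^-1).
Proof.
elim: n f => // n IH f fu [g sg fg].
have sV : smooth n (fun u => (f u)^-1) by apply: IH => //; apply: smoothW; exists g.
exists (fun u => -1 * g u * ((f u)^-1 * (f u.+1)^-1)).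
  apply: smoothM; last by apply: smoothM => //; apply: (smoothS sV).
  by apply: smoothM => //; apply: smooth_const.
move=> u; apply: (mulrI (fu u)); apply: (mulrI (fu u.+1)).
have E (x y z : R) : x \is a GRing.unit -> y \is a GRing.unit ->
    x * (y * (y^-1 + q * (-1 * z * (y^-1 * x^-1)))) = x - q * z.
  move=> xu yu; transitivity (x * (y / y) - q * z * ((y / y) * (x / x))); first by ring.
  by rewrite !divrr //; ring.
by rewrite E // mulrCA mulrV // mulr1 fg; ring.
Qed.

(** One step along the progression is [w] unit steps, so the new difference is a sum of [w] values
    of [g], each again taken along a progression. *)
Lemma smooth_affine n f (c w : nat) : smooth n f ->
  smooth n (fun u => f (c + w * u)%N).
Proof.
elim: n f c w => // n IH f c w [g sg fg].
have fgD x v : f (x + v)%N = f x + q * \sum_(0 <= i < v) g (x + i)%N.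
  elim: v => [|v IHv]; first by rewrite addn0 big_geq // mulr0 addr0.
  by rewrite addnS fg IHv big_nat_recr //= mulrDr addrA.
exists (fun u => \sum_(0 <= i < w) g (c + w * u + i)%N); last first.
  by move=> u; rewrite mulnSr addnA fgD.
elim: (index_iota 0 w) => [|i r IHr].
  by apply: eq_smooth (smooth_const n 0) => u; rewrite big_nil.
apply: (@eq_smooth n (fun u => g (c + i + w * u)%N +
    \sum_(j <- r) g (c + w * u + j)%N)); first by move=> u; rewrite big_cons addnAC.
by apply: smoothD => //; apply: IH.
Qed.

(** The difference of [f] is [q f k], so each order already known for [f] yields the next one, as
    far as [k] allows. *)
Lemma smooth_recursion n f k : smooth n k ->
  (forall u, f u.+1 = f u * (1 + q * k u)) -> smooth n.+1 f.
Proof.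
elim: n k => [|n IH] k sk fk; exists (fun u => f u * k u) => //.
- by move=> u; rewrite fk; ring.
- by apply: smoothM => //; apply: IH fk; apply: smoothW.
- by move=> u; rewrite fk; ring.
Qed.

End Smooth.

(** Newton interpolation: if [f] vanishes at [1, .., n.+1], its divided difference [g] vanishes at
    [1, .., n], and [f 0 = - q g 0]. *)
Lemma smooth_vanish (R : idomainType) (q : R) n (f : nat -> R) : q != 0 ->
  smooth q n f -> (forall i, (0 < i <= n)%N -> f i = 0) ->
  exists z, f 0%N = q ^+ n * z.
Proof.
move=> q0; elim: n f => [|n IH] f; first by exists (f 0%N); rewrite mul1r.
move=> [g sg fg] f0.
have [i /andP[i0 ile]|z gz] := IH g sg.
  apply: (mulfI q0); rewrite mulr0; apply: (addrI (f i)); rewrite -fg addr0.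
  by rewrite !f0 ?i0 // ltnW.
exists (- z); rewrite exprS mulrN -mulrA -gz; apply: (addIr (q * g 0%N)).
by rewrite -fg addNr f0.
Qed.

(** * Morita's Gamma function *)

Section PadicDivisibility.
Variables (p : nat) (p_pr : prime p).
Local Notation Zp := (padic_int p_pr).
Implicit Types (x y z : Zp) (n k : nat).

Lemma residue_eqP n x y : x n = y n <-> exists z, x = y + p%:R ^+ n * z.
Proof.
have pn0 m : p%:Z ^+ m != 0 by rewrite expf_neq0 // eqz_nat -lt0n prime_gt0.
have resp m k : ((p%:R ^+ m : Zp) k = p%:Z ^+ m %[mod p%:Z ^+ k])%Z.
  by rewrite -natrX residue_natr modz_mod -pexpz.
split=> [exy|[z ->]]; last first.
  rewrite residueD residueM -(modzMml ((p%:R ^+ n : Zp) n)) resp modzMml.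
  by rewrite modzMr addr0 residue_mod.
pose d := x - y.
have d0 : d n = 0 by rewrite residueD residueN modzDmr exy subrr mod0z.
have dvd_d m : (p%:Z ^+ n %| d (m + n)%N)%Z.
  by apply/dvdz_mod0P; rewrite residue_le ?leq_addl.
(* Division by [p ^ n] loses [n] digits, so level [m] of the quotient is read off level [m + n]. *)
pose u m := (d (m + n)%N %/ p%:Z ^+ n)%Z.
have du m : d (m + n)%N = p%:Z ^+ n * u m by rewrite mulrC divzK.
have cu : coherent p u.
  move=> m; apply/eqP; rewrite eqz_mod_dvd -(@dvdz_mul2l (p%:Z ^+ n)) //.
  rewrite mulrBr -!du -exprD -eqz_mod_dvd addSn [(n + m)%N]addnC; apply/eqP.
  by rewrite [X in (X = _ %[mod _])%Z]residueP modz_mod.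
exists (mkpadic p_pr cu).
apply/(addrI (- y)); rewrite addKr addrC -/d; apply: padic_intP => k.
rewrite residueM -modzMml resp modzMml /= modzMmr -du residue_le //.
exact: leq_addr.
Qed.

Lemma padic_unitE x : (x \is a GRing.unit) = (x 1%N != 0).
Proof.
apply/idP/idP => [xu|x1].
  apply/eqP => x0; have : (x / x) 1%N = (1 : Zp) 1%N by rewrite divrr.
  rewrite residueM x0 mul0r mod0z (residue_natr p_pr 1) expr1 modz_nat.
  by rewrite modn_small ?prime_gt1.
have cop n : coprimez (p%:Z ^+ n) (x n).
  case: n => [|n]; first by rewrite expr0 coprimezE coprime1n.
  rewrite pexpz coprimezE /= coprimeXl // prime_coprime //; apply: contra x1 => dv.
  rewrite -(residue_le x (ltn0Sn n)) expr1; apply/eqP; apply/dvdz_mod0P.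
  by rewrite dvdzE.
pose u n := (egcdz (x n) (p%:Z ^+ n)).1.
have ux n : (u n * x n = 1 %[mod p%:Z ^+ n])%Z.
  rewrite /u; case: egcdzP => a b e _ /=; move: e.
  by have := cop n; rewrite coprimez_sym => /eqP -> <-; rewrite addrC modzMDl.
have cu : coherent p u.
  move=> n; apply/eqP; rewrite eqz_mod_dvd -(Gauss_dvdzl _ (cop n)) mulrBl.
  rewrite -eqz_mod_dvd ux [x n]residueP modzMmr; apply/eqP; symmetry.
  exact: eqmodz_trunc (leqnSn n) (ux n.+1).
have yx : mkpadic p_pr cu * x = 1.
  apply: padic_intP => n; rewrite residueM /= modzMml ux.
  by apply/esym/(residue_natr p_pr 1).
by apply/unitrP; exists (mkpadic p_pr cu); rewrite [x * _]mulrC.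
Qed.

Lemma padic_nunitP x : x \isn't a GRing.unit <-> exists y, x = p%:R * y.
Proof.
rewrite padic_unitE negbK; split=> [/eqP x1|[y ->]].
  have [z ->] : exists z, x = 0 + p%:R ^+ 1 * z.
    by apply/residue_eqP; rewrite x1 (residue_natr p_pr 0) mod0z.
  by exists z; rewrite add0r.
have -> : (p%:R * y) 1%N = (0 : Zp) 1%N.
  by apply/residue_eqP; exists y; rewrite add0r.
by rewrite (residue_natr p_pr 0) mod0z.
Qed.

Lemma padic_intr_unitD (k : int) z :
  ~~ (p %| `|k|)%N -> (k%:~R + p%:R * z : Zp) \is a GRing.unit.
Proof.
move=> kp; rewrite padic_unitE.
have -> : (k%:~R + p%:R * z : Zp) 1%N = (k%:~R : Zp) 1%N.
  by apply/residue_eqP; exists z.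
by rewrite -padic_unitE; apply: padic_intr_unit; rewrite prime_coprime.
Qed.

(** Density of the natural numbers, through which identities for [Gamma_nat] pass to [Z_p]. *)
Lemma residue_nat x n : exists k, x n = (k%:R : Zp) n.
Proof.
by exists `|x n|%N; rewrite residue_natr gez0_abs ?residue_ge0 // residue_mod.
Qed.

Lemma padic_intSP x y : (forall n, x n.+1 = y n.+1) -> x = y.
Proof. by move=> xy; apply: padic_intP => n; rewrite !(residueP _ n) xy. Qed.

End PadicDivisibility.

(** * Functional equation, reflection and differences of [Gamma_p] *)

Section Gamma.
Variables (p : nat) (p_pr : prime p) (p_odd : odd p).
Local Notation Zp := (padic_int p_pr).
Local Notation G := (@padic_Gamma p p_pr).
Implicit Types (x y z : Zp) (n k : nat).

Lemma Gamma_natS k :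
  Gamma_nat p k.+1 = - (if (p %| k)%N then 1 else k%:Z) * Gamma_nat p k.
Proof.
rewrite /Gamma_nat exprS mulN1r mulNr mulNr; congr (- _); rewrite [RHS]mulrCA.
congr (_ * _); case: k => [|k]; first by rewrite dvdn0 !big_geq // mulr1.
rewrite big_mkcond big_nat_recr //= -big_mkcond /= mulrC.
by case: (p %| k.+1)%N.
Qed.

Lemma padic_Gamma_nat k : G k%:R = (Gamma_nat p k)%:~R.
Proof. by have [_ ->] := padic_GammaP p_pr p_odd. Qed.

(** Sharper than continuity, as the level is the same on both sides. Continuity replaces the
    argument by a close natural number, and for these the congruence is [Gamma_nat_mod]. *)
Lemma padic_Gamma_residue n x y : x n = y n -> G x n = G y n.
Proof.
case: n => [_|n].
  by rewrite -[LHS]residue_mod -[RHS]residue_mod expr0 !modz1.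
have red z : G z n.+1 = (Gamma_nat p `|z n.+1|%N %% p%:Z ^+ n.+1)%Z.
  have [m Hm] := (padic_GammaP p_pr p_odd).1 z n.+1.
  pose k := `|z (maxn m n.+1)|%N.
  have kz c : (c <= maxn m n.+1)%N -> (k%:R : Zp) c = z c.
    by move=> cm; rewrite residue_natr gez0_abs ?residue_ge0 // residue_le.
  rewrite -(Hm _ (kz _ (leq_maxl _ _))) padic_Gamma_nat residue_intr.
  apply: Gamma_nat_mod => //.
  have e : (k = `|z n.+1|%N %[mod p%:Z ^+ n.+1])%Z.
    have := kz n.+1 (leq_maxr _ _); rewrite residue_natr => ->.
    by rewrite gez0_abs ?residue_ge0 // residue_mod.
  by move: e; rewrite pexpz !modz_nat => -[].
by move=> xy; rewrite !red xy.
Qed.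

Lemma padic_GammaS x : G (x + 1) = - (if x \is a GRing.unit then x else 1) * G x.
Proof.
apply: padic_intSP => n; have [k xk] := residue_nat x n.+1.
have xk1 : x 1%N = (k%:R : Zp) 1%N.
  by rewrite -!(residue_le _ (ltn0Sn n)) xk.
have dk : (x \is a GRing.unit) = ~~ (p %| k)%N.
  by rewrite padic_unitE xk1 residue_natr expr1 modz_nat eqz_nat.
have -> : G (x + 1) n.+1 = G (k%:R + 1) n.+1.
  by apply: padic_Gamma_residue; rewrite !residueD xk.
rewrite natr1 padic_Gamma_nat Gamma_natS dk intrM -padic_Gamma_nat.
rewrite residueM [RHS]residueM (padic_Gamma_residue xk); congr ((_ * _) %% _)%Z.
by case: (p %| k)%N => //=; rewrite residue_intr xk residue_natr modzNm.
Qed.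

Lemma padic_GammaS_unit x : x \is a GRing.unit -> G (x + 1) = - x * G x.
Proof. by rewrite padic_GammaS => ->. Qed.

Lemma padic_GammaS_mulp y : G (p%:R * y + 1) = - G (p%:R * y).
Proof.
rewrite padic_GammaS ifF ?mulN1r //; apply/negbTE/padic_nunitP.
by exists y.
Qed.

Lemma padic_Gamma0 : G 0 = 1.
Proof. by rewrite (padic_Gamma_nat 0) /Gamma_nat big_geq. Qed.

Lemma padic_Gamma1 : G 1 = -1.
Proof. by rewrite (padic_Gamma_nat 1) /Gamma_nat big_geq ?mulr1. Qed.

Lemma padic_Gamma_rising x n :
  (forall j, (j < n)%N -> x + j%:R \is a GRing.unit) ->
  G (x + n%:R) = (-1) ^+ n * rising x n * G x.
Proof.
elim: n => [|n IH] xu; first by rewrite rising0 addr0 !mul1r.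
rewrite -natr1 addrA padic_GammaS_unit ?xu // IH => [|j jn]; last exact/xu/ltnW.
by rewrite risingS exprS; ring.
Qed.

(** At the one multiple of [p] the functional equation contributes only the sign, so that factor is
    missing from the product. *)
Lemma padic_Gamma_rising_skip x n j0 : (j0 < n)%N ->
  x + j0%:R \isn't a GRing.unit ->
  (forall j, (j < n)%N -> j != j0 -> x + j%:R \is a GRing.unit) ->
  G (x + n%:R) =
    (-1) ^+ n * (rising x j0 * rising (x + j0.+1%:R) (n - j0.+1)) * G x.
Proof.
move=> j0n /padic_nunitP[y xj0] xu.
have -> : x + n%:R = x + j0.+1%:R + (n - j0.+1)%:R by rewrite natrB //; ring.
rewrite padic_Gamma_rising => [|j jn]; last first.
  by rewrite -addrA -natrD; apply: xu; lia.
rewrite -natr1 addrA xj0 padic_GammaS_mulp -xj0 padic_Gamma_rising => [|j jn]; last first.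
  by apply: xu; lia.
have -> : (-1) ^+ n = (-1) ^+ j0.+1 * (-1) ^+ (n - j0.+1) :> Zp.
  by rewrite -exprD subnKC.
by rewrite exprS; ring.
Qed.

(** Under [x |-> x + 1] the product [f] changes sign at units and is kept at multiples of [p]. From
    [p v] to [p (v + 1)] there are [p - 1] sign changes, an even number, so [f (p v) = f 0 = -1];
    density gives all [p y]. *)
Lemma padic_Gamma_reflect y (l : nat) : (0 < l <= p)%N ->
  G (l%:R + p%:R * y) * G (1 - (l%:R + p%:R * y)) = (-1) ^+ l.
Proof.
pose f x := G x * G (1 - x).
have fS x : f (x + 1) = (if x \is a GRing.unit then -1 else 1) * f x.
  rewrite /f padic_GammaS.
  have -> : 1 - (x + 1) = - x by ring.
  have -> : 1 - x = - x + 1 by rewrite addrC.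
  by rewrite (padic_GammaS (- x)) unitrN; case: ifP => _; ring.
have step x : f (p%:R * x) = -1 -> forall l, (0 < l <= p)%N -> f (l%:R + p%:R * x) = (-1) ^+ l.
  move=> fx; elim=> // -[|k] IH kp.
    rewrite addrC fS ifF ?mul1r // padic_unitE; apply/negbTE.
    by rewrite -padic_unitE; apply/padic_nunitP; exists x.
  rewrite -natr1 addrAC fS IH ?(ltnW (proj2 (andP kp))) // ifT ?exprS //.
  rewrite -[k.+1%:R]/(k.+1%:Z%:~R); apply: padic_intr_unitD => /=.
  by apply/negP => /dvdn_leq -/(_ isT); lia.
have natp v : f (p%:R * v%:R) = -1.
  elim: v => [|v IH]; first by rewrite mulr0 /f subr0 padic_Gamma0 padic_Gamma1 mul1r.
  rewrite -natr1 mulrDr mulr1 addrC step ?prime_gt0 ?leqnn // -signr_odd p_odd //.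
apply: (step y); apply: padic_intP => n; have [k yk] := residue_nat y n.
rewrite -(natp k) /f !residueM.
have e : (p%:R * y) n = (p%:R * k%:R : Zp) n by rewrite !residueM yk.
rewrite (padic_Gamma_residue e) (@padic_Gamma_residue n (1 - p%:R * y) (1 - p%:R * k%:R)) //.
by rewrite !residueD !residueN e.
Qed.

Lemma padic_Gamma_unit x : G x \is a GRing.unit.
Proof.
have [k xk] := residue_nat x 1; have p0 := prime_gt0 p_pr.
suff [l [y [lp ->]]] : exists l y, (0 < l <= p)%N /\ x = l%:R + p%:R * y.
  have := padic_Gamma_reflect y lp; set X := G _; set Y := G _ => XY.
  have : X * Y \is a GRing.unit by rewrite XY unitrX ?unitrN1.
  by rewrite unitrM => /andP[].
have [z ->] := (residue_eqP 1 x k%:R).1 xk; case: k {xk} => [|k].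
  by exists p, (z - 1); rewrite p0 leqnn; split=> //; ring.
exists (k %% p).+1, (z + (k %/ p)%:R); rewrite ltn_mod p0; split=> //.
by rewrite -!natr1 {1}(divn_eq k p) natrD natrM; ring.
Qed.

Lemma prod_Fp : \prod_(1 <= j < p) ('X + j%:R) = 'X^(p.-1) - 1 :> {poly 'F_p}.
Proof.
have X0 : 'X != 0 :> {poly 'F_p} by rewrite polyX_eq0.
apply: (mulfI X0); rewrite mulrBr mulr1 -exprS prednK ?prime_gt0 //.
transitivity (\prod_(0 <= j < p) ('X + j%:R) : {poly 'F_p}).
  by rewrite [RHS]big_ltn ?prime_gt0 // addr0.
have := finField_genPoly 'F_p; rewrite card_Fp // => ->.
have aux M : p = M -> \prod_(0 <= j < p) ('X + j%:R) = \prod_(j < M) ('X + (j : nat)%:R) :> {poly 'F_p}.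
  by move=> <-; rewrite big_mkord.
rewrite (aux _ (esym (Fp_cast p_pr))) [RHS](reindex_inj (@oppr_inj _)) /=.
by apply: eq_bigr => x _; rewrite polyCN opprK -{2}(natr_Zp x) polyC_natr.
Qed.

(** The identity in ['F_p] makes the difference of the two integral polynomials divisible by [p]
    coefficientwise. *)
Lemma prod_modp : exists F : {poly Zp},
  \prod_(1 <= j < p) ('X + j%:R) = 'X^(p.-1) - 1 + p%:R *: F.
Proof.
pose H : {poly int} := \prod_(1 <= j < p) ('X + j%:R) - ('X^(p.-1) - 1).
have dvH i : (p%:Z %| H`_i)%Z.
  have : (map_poly (intr : int -> 'F_p) H)`_i = 0.
    rewrite /H rmorphB rmorph_prod /=.
    under eq_bigr => j _ do rewrite rmorphD /= map_polyX rmorph_nat.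
    by rewrite prod_Fp rmorphB rmorph1 /= map_polyXn subrr coef0.
  rewrite coef_map /= => /eqP; rewrite dvdzE.
  have dvF (a : nat) : (a%:R == 0 :> 'F_p) = (p %| a)%N.
    by rewrite -val_eqE /= val_Fp_nat.
  by case: (H`_i) => a; rewrite ?NegzE ?rmorphN ?oppr_eq0 /= ?abszN dvF.
pose F : {poly int} := \poly_(i < size H) (H`_i %/ p%:Z)%Z.
have HF : H = p%:R *: F.
  apply/polyP => i; rewrite coefZ coef_poly; case: ltnP => iH; last first.
    by rewrite mulr0 nth_default.
  by rewrite mulrC natz divzK.
exists (map_poly intr F).
have := congr1 (map_poly (intr : int -> Zp)) HF.
rewrite map_polyZ /= rmorph_nat => <-.
rewrite /H rmorphB rmorph_prod /=.
under [\prod_(1 <= j < p) map_poly _ _]eq_bigr => j _ do rewrite rmorphD /= map_polyX rmorph_nat.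
by rewrite rmorphB rmorph1 /= map_polyXn; ring.
Qed.

Hypothesis p_ge7 : (7 <= p)%N.

(** From [p u] to [p (u + 1)], [Gamma_p] is multiplied by minus the product of the [p u + j] with
    [0 < j < p], which by [prod_modp] is [1 + p k(u)] with [k] of order 4; [smooth_recursion] gains
    the fifth order. *)
Lemma smooth_padic_Gamma (c w : Zp) :
  smooth p%:R 5 (fun u => G (c + p%:R * (w * u%:R))).
Proof.
have nunit u k : ((p * u + k)%:R : Zp) \is a GRing.unit = ~~ (p %| k)%N.
  rewrite -[(p * u + k)%:R]/((p * u + k)%:Z%:~R) padic_unitE residue_intr expr1.
  rewrite modz_nat eqz_nat mulnC modnMDl //.
have prodG u n : G (p * u + n)%:R = G (p * u)%:R *
    \prod_(0 <= j < n) (if (p %| j)%N then -1 else - (p%:R * u%:R + j%:R)).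
  elim: n => [|n IH]; first by rewrite addn0 big_geq ?mulr1.
  rewrite addnS -natr1 padic_GammaS nunit IH big_nat_recr //= natrD natrM.
  by case: (p %| n)%N => /=; ring.
have base : smooth p%:R 5 (fun u => G (p * u)%:R).
  have [F HF] := prod_modp.
  (* The second summand is [- (p u) ^ (p - 1) / p]. It is not presented as a polynomial in [p u],
     but its factor [p ^ 4] already gives order 4. *)
  apply: (@smooth_recursion _ _ _ _ (fun u => - F.[p%:R * u%:R] + p%:R ^+ 4 * (- (p%:R ^+ (p - 6) * u%:R ^+ p.-1)))).
    apply: smoothD; last exact: smooth_exp.
    by apply: eq_smooth (smooth_horner _ _ (- F)) => u; rewrite hornerN.
  move=> u; rewrite mulnS addnC prodG; congr (_ * _).
  rewrite big_ltn ?prime_gt0 // dvdn0 mulN1r.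
  have -> : \prod_(1 <= j < p) (if (p %| j)%N then -1 else - (p%:R * u%:R + j%:R)) =
     (\prod_(1 <= j < p) ('X + j%:R)).[p%:R * u%:R] :> Zp.
    rewrite horner_prod big_nat [RHS]big_nat.
    rewrite (eq_bigr (fun j : nat => -1 * (p%:R * u%:R + j%:R))); last first.
      move=> j /andP[j0 jp]; rewrite ifF ?mulN1r //; apply/negP => /dvdn_leq -/(_ j0).
      by rewrite leqNgt jp.
    rewrite big_split /= -big_nat big_const_nat iter_mulr_1 -signr_odd oddB ?prime_gt0 // p_odd mul1r.
    by apply: eq_bigr => j _; rewrite hornerD hornerX -polyC_natr hornerC.
  have pp : p%:R ^+ p.-1 = p%:R * p%:R ^+ 4 * p%:R ^+ (p - 6) :> Zp.
    by rewrite -exprS -exprD; congr (_ ^+ _); lia.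
  by rewrite HF !hornerD hornerZ hornerN hornerXn hornerC exprMn pp; ring.
have smooth_nat k : smooth p%:R 5 (fun u => G (p * u + k)%:R).
  apply: (@eq_smooth _ _ _ (fun u => G (p * u)%:R *
    \prod_(0 <= j < k) (if (p %| j)%N then -1 else - (p%:R * u%:R + j%:R)))).
    by move=> u; rewrite -prodG.
  apply: smoothM => //; apply: (smooth_prod _
    (F := fun j u => if (p %| j)%N then -1 else - (p%:R * u%:R + j%:R))) => j.
  case: (p %| j)%N; first exact: smooth_const.
  apply: eq_smooth (smooth_horner _ _ (- ('X + j%:R%:P))) => u.
  by rewrite hornerN hornerD hornerX hornerC.
(* Order 5 depends only on values modulo [p ^ 5], and these on the arguments modulo [p ^ 5]; so [c]
   and [w] may be taken to be natural numbers. *)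
have [c0 hc] := residue_nat c 5; have [w0 hw] := residue_nat w 5.
apply: (smooth_eqmod _ (smooth_affine 0 w0 (smooth_nat c0))) => u /=.
apply/residue_eqP/padic_Gamma_residue.
rewrite add0n natrD !natrM [in RHS]addrC.
by rewrite !residueD !residueM hc hw.
Qed.

End Gamma.

(** * Closed forms and interpolation *)

Lemma rmorph_rising (R S : comNzRingType) (f : {rmorphism R -> S}) x k :
  f (rising x k) = rising (f x) k.
Proof.
by rewrite rmorph_prod; apply: eq_bigr => i _; rewrite rmorphD rmorph_nat.
Qed.

Lemma rmorph_wellpoised (R S : comNzRingType) (f : {rmorphism R -> S}) a gs n :
  f (wellpoised a gs n) = wellpoised (f a) (map f gs) n.
Proof.
rewrite rmorph_sum; apply: eq_bigr => k _.
rewrite rmorphM rmorphD rmorphMn rmorph_nat rmorph_prod big_map /=.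
congr (_ * _); apply: eq_bigr => g _.
by rewrite rmorphM !rmorph_rising rmorphD rmorphB rmorphD rmorph1 rmorph_nat.
Qed.

Lemma rising1 (R : comNzRingType) n : rising (1 : R) n = n`!%:R.
Proof.
by elim: n => [|n IH]; rewrite ?rising0 // risingS IH factS natrM -natr1 mulrC addrC.
Qed.

Lemma rising_unit (R : comUnitRingType) (x : R) n :
  (forall j, (j < n)%N -> x + j%:R \is a GRing.unit) ->
  rising x n \is a GRing.unit.
Proof.
elim: n => [|n IH] xu; first by rewrite rising0 unitr1.
by rewrite risingS unitrM IH ?xu // => j jn; apply/xu/ltnW.
Qed.

Lemma wellpoised_perm (R : comNzRingType) (a : R) gs hs n :
  perm_eq gs hs -> wellpoised a gs n = wellpoised a hs n.
Proof. by move=> gh; apply: eq_bigr => k _; congr (_ * _); apply: perm_big. Qed.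

(** A parameter [- m] kills all terms beyond [m]; the extra product only records that denominators
    were cleared up to length [n]. *)
Lemma wellpoised_cut (R : comNzRingType) (a : R) gs m n : (m <= n)%N ->
  - m%:R \in gs ->
  wellpoised a gs n =
    wellpoised a gs m * \prod_(g <- gs) rising (1 + a - g + m%:R) (n - m).
Proof.
move=> mn gsm; rewrite /wellpoised (@big_cat_nat _ _ _ m.+1) //=.
rewrite [X in _ + X]big_nat [X in _ + X]big1 ?addr0; last first.
  move=> k /andP[mk _]; rewrite (big_rem _ gsm) /= rising_opp_nat //.
  by rewrite !mul0r mulr0.
rewrite big_distrl /=; apply: eq_big_nat => k /andP[_ km].
rewrite -mulrA -big_split; congr (_ * _); apply: eq_bigr => g _ /=.
rewrite -mulrA; congr (_ * _).
have -> : (n - k = (m - k) + (n - m))%N by lia.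
by rewrite rising_cat; congr (_ * rising _ _); rewrite natrB //; ring.
Qed.

Definition rising_skip (R : pzRingType) (x : R) j0 n :=
  rising x j0 * rising (x + j0.+1%:R) (n - j0.+1).

Lemma rising_skipE (R : comNzRingType) (x : R) j0 n : (j0 < n)%N ->
  rising x n = (x + j0%:R) * rising_skip x j0 n.
Proof.
by move=> jn; rewrite -{1}(subnKC jn) rising_cat risingS /rising_skip; ring.
Qed.

(** * Dougall's theorem at the interpolation points, in terms of [Gamma_p] *)

Section Deformation.
Variables (p : nat) (p_pr : prime p) (p_odd : odd p) (p_ge7 : (7 <= p)%N).
Local Notation Zp := (padic_int p_pr).
Local Notation G := (@padic_Gamma p p_pr).
Variables (N M : nat).
Hypotheses (pNM : p = (N.*2 + M).+1) (M_gt0 : (0 < M)%N) (MN : (M < N)%N).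

(** Residues are tracked as explicit integers: one that is nonzero and below [p] in absolute value
    marks a unit, which linear arithmetic decides. *)
Definition congp (x : Zp) (k : int) := exists y, x = k%:~R + p%:R * y.

Lemma congpD x y k l : congp x k -> congp y l -> congp (x + y) (k + l).
Proof.
by move=> [u ->] [v ->]; exists (u + v); rewrite intrD; ring.
Qed.

Lemma congpN x k : congp x k -> congp (- x) (- k).
Proof. by move=> [u ->]; exists (- u); rewrite mulrNz; ring. Qed.

Lemma congp_nat k : congp k%:R k%:Z.
Proof. by exists 0; rewrite mulr0 addr0. Qed.

Lemma congp_unit x (k : int) : congp x k -> k != 0 -> (`|k| < p)%N ->
  x \is a GRing.unit.
Proof.
move=> [y ->] k0 kp; apply: padic_intr_unitD; apply/negP => /dvdn_leq.
by rewrite absz_gt0 => /(_ k0); rewrite leqNgt kp.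
Qed.

Lemma congp_nunit x : congp x 0 -> x \isn't a GRing.unit.
Proof. by move=> [y ->]; apply/padic_nunitP; exists y; rewrite add0r. Qed.

Lemma congp_reflect x (l : nat) : congp x l -> (0 < l <= p)%N ->
  G x * G (1 - x) = (-1) ^+ l.
Proof. by move=> [y ->] lp; apply: padic_Gamma_reflect. Qed.

Lemma M_even : (-1) ^+ M = 1 :> Zp.
Proof.
rewrite -signr_odd; suff -> : odd M = false by [].
by move: p_odd; rewrite pNM /= oddD odd_double; case: (odd M).
Qed.

(* Dougall's sum at the points where one parameter is a nonpositive integer,
   rewritten through [G]. *)
Section ClosedForm.
Variables (a b c d f e : Zp).
Hypothesis bal : 1 + a *+ 2 = b + c + d + f + e.
Hypotheses (ha : congp a (- N%:Z)) (hb : congp b (- N%:Z))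
  (hc : congp c (- N%:Z)) (hd : congp d (- N%:Z)).

Let GammaT := G (1 + a) *
  (G (1 + a - b - c) * G (1 + a - b - d) * G (1 + a - c - d) *
   G (1 + a - b - f) * G (1 + a - c - f) * G (1 + a - d - f) *
   G (1 + a - b - e) * G (1 + a - c - e) * G (1 + a - d - e) * G (1 + a - f - e)).
Let GammaL := G (1 + a - b) * G (1 + a - c) * G (1 + a - d) * G (1 + a - f) *
  G (1 + a - e).

Let one : congp 1 1. Proof. exact: (congp_nat 1). Qed.

Let h1 x : congp x (- N%:Z) -> congp (1 + a - x) 1.
Proof.
move=> hx; have := congpD (congpD one ha) (congpN hx).
by have -> : 1 + - N%:Z - - N%:Z = 1 by lia.
Qed.

Let h2 x y : congp x (- N%:Z) -> congp y (- N%:Z) ->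
  congp (1 + a - x - y) (1 + N)%N.
Proof.
move=> hx hy; have := congpD (h1 hx) (congpN hy).
by have -> : 1 - - N%:Z = (1 + N)%N by lia.
Qed.

Let unitD x (k : int) j : congp x k -> k + j%:Z != 0 -> (`|(k + j%:Z)%R| < p)%N ->
  x + j%:R \is a GRing.unit.
Proof. by move=> hx; apply/congp_unit/congpD/congp_nat. Qed.

Let Gamma1 x n : congp x (- N%:Z) -> (n <= N)%N ->
  G (1 + a - x + n%:R) = (-1) ^+ n * rising (1 + a - x) n * G (1 + a - x).
Proof.
move=> hx nN; apply: padic_Gamma_rising => // j jn.
by apply: unitD (h1 hx) _ _; lia.
Qed.

Let Gamma2 x y n : congp x (- N%:Z) -> congp y (- N%:Z) -> (n <= N)%N ->
  G (1 + a - x - y + n%:R) =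
  (-1) ^+ n * rising (1 + a - x - y) n * G (1 + a - x - y).
Proof.
move=> hx hy nN; apply: padic_Gamma_rising => // j jn.
by apply: unitD (h2 hx hy) _ _; lia.
Qed.

(** Every rising factorial of Dougall's product is a quotient of two values of [Gamma_p]. Multiples
    of [p] are met twice: [a + N] in [rising a N.*2.+1], and the factor of index [N - M - 1] in
    [rising (1 + a - f) N], as [1 + a - f] is [1 - N + M] modulo [p]. *)
Lemma closed_form_N : congp f (- M%:Z) -> e = - N%:R ->
  wellpoised a [:: a; b; c; d; f; e] N * GammaT =
  (-1) ^+ N.+1 * (a + N%:R) *
  (a * N`!%:R * (rising (1 + a - b) N * rising (1 + a - c) N *
    rising (1 + a - d) N * rising (1 + a - e) N *
    rising_skip (1 + a - f) (N - M.+1) N)) * GammaL.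
Proof.
move=> hf he.
have fE : f = 1 + a *+ 2 - b - c - d + N%:R by rewrite bal he; ring.
have nz j : (0 < j <= N)%N -> f - j%:R != 0.
  move=> jN; have := congpD hf (congpN (congp_nat j)).
  by move/congp_unit => fu; apply: contraTneq (fu _ _) => [->||]; rewrite ?unitr0 //; lia.
have := dougall fE nz; rewrite -he => ->.
have hdf x y : congp x (- N%:Z) -> congp y (- M%:Z) ->
    congp (1 + a - x - y) (1 + M)%N.
  move=> hx hy; have := congpD (h1 hx) (congpN hy).
  by have -> : 1 - - M%:Z = (1 + M)%N by lia.
have N0 : (N.-1 < N)%N by lia.
have g0 : G (1 + a - e) = (-1) ^+ N * rising (1 + a) N.-1 * G (1 + a).
  rewrite he opprK (@padic_Gamma_rising_skip _ _ _ _ _ N.-1) //.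
  - by rewrite prednK ?subnn ?rising0 ?mulr1 //; lia.
  - apply: congp_nunit; have := congpD (congpD one ha) (congp_nat N.-1).
    by have -> : 1 + - N%:Z + N.-1 = 0 by lia.
  - by move=> j jN jN1; apply: unitD (congpD one ha) _ _; lia.
(* By balancing, the argument of the pair [z, f] reflects that of [x, y] shifted by [N]. The sign is
   [(-1) ^ (M + 1)], and [M] is even. *)
have refl x y z : congp x (- N%:Z) -> congp y (- N%:Z) -> congp z (- N%:Z) ->
    1 + a - z - f = 1 - (1 + a - x - y - e) ->
    (-1) ^+ N * rising (1 + a - x - y) N * G (1 + a - x - y) * G (1 + a - z - f) = -1.
  move=> hx hy hz ez.
  rewrite -Gamma2 // -[N%:R]opprK -he.
  have -> : 1 + a - x - y - e = 1 - (1 + a - z - f) by rewrite ez; ring.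
  rewrite mulrC (congp_reflect (hdf _ _ hz hf)); last by lia.
  by rewrite exprS M_even mulr1.
have rbc := refl _ _ _ hb hc hd; have rbd := refl _ _ _ hb hd hc.
have rcd := refl _ _ _ hc hd hb.
have gf : G (1 + a - f - e) = (-1) ^+ N * rising_skip (1 + a - f) (N - M.+1) N * G (1 + a - f).
  have h : congp (1 + a - f) (1 - N%:Z + M%:Z).
    have := congpD (congpD one ha) (congpN hf).
    by have -> : 1 + - N%:Z - - M%:Z = 1 - N%:Z + M%:Z by lia.
  rewrite he opprK (@padic_Gamma_rising_skip _ _ _ _ _ (N - M.+1)) //; first by lia.
  - apply: congp_nunit; have := congpD h (congp_nat (N - M.+1)).
    by have -> : 1 - N%:Z + M%:Z + (N - M.+1)%N = 0 by lia.
  - by move=> j jN jN1; apply: unitD h _ _; lia.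
have gx x : congp x (- N%:Z) ->
    G (1 + a - x - e) = (-1) ^+ N * rising (1 + a - x) N * G (1 + a - x).
  by move=> hx; rewrite he opprK Gamma1.
have ra : rising a N.*2.+1 =
    a * rising (1 + a) N.-1 * (a + N%:R) * rising (1 + a - e) N.
  have -> : (N.*2.+1 = (N.-1).+2 + N)%N by rewrite -addnn; lia.
  have Nn : N%:R = N.-1%:R + 1 :> Zp by rewrite natr1 prednK //; lia.
  rewrite rising_cat risingSl risingS he opprK -!natr1 Nn (addrC a 1).
  have -> : 1 + a + N.-1%:R = a + (N.-1%:R + 1) by ring.
  have -> : a + (N.-1%:R + 1 + 1) = 1 + a + (N.-1%:R + 1) by ring.
  by rewrite !mulrA.
have ee : (-1) ^+ N * (-1) ^+ N = 1 :> Zp by rewrite -expr2 sqrr_sign.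
rewrite /GammaT /GammaL ra (gx _ hb) (gx _ hc) (gx _ hd) gf exprS g0.
move: rbc rbd rcd; set s := a + _; set eps := (-1) ^+ N in ee *.
set r1 := rising (1 + a) _.
have -> : 1 + a - d - f = 1 - (1 + a - b - c - e).
  by rewrite -[e](addKr (b + c + d + f)) -bal; ring.
have -> : 1 + a - c - f = 1 - (1 + a - b - d - e).
  by rewrite -[e](addKr (b + c + d + f)) -bal; ring.
have -> : 1 + a - b - f = 1 - (1 + a - c - d - e).
  by rewrite -[e](addKr (b + c + d + f)) -bal; ring.
move=> /(_ erefl) rbc /(_ erefl) rbd /(_ erefl) rcd.
move: rbc rbd rcd.
set xbc := rising (1 + a - b - c) N; set xbd := rising (1 + a - b - d) N.
set xcd := rising (1 + a - c - d) N.
set Gbc := G (1 + a - b - c); set Gbd := G (1 + a - b - d).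
set Gcd := G (1 + a - c - d).
set Gdf := G (1 - _); set Gcf := G (1 - _); set Gbf := G (1 - _).
move=> rbc rbd rcd.
set ga := G (1 + a); set gb := G (1 + a - b); set gc := G (1 + a - c).
set gd := G (1 + a - d); set gff := G (1 + a - f).
set xb := rising (1 + a - b) N; set xc := rising (1 + a - c) N.
set xd := rising (1 + a - d) N; set xe := rising (1 + a - e) N.
set sk := rising_skip _ _ _.
transitivity (N`!%:R * a * r1 * s * xe * ga * (xb * xc * xd * sk * gb * gc * gd * gff)
  * (eps * eps) * ((eps * xbc * Gbc * Gdf) * (eps * xbd * Gbd * Gcf) * (eps * xcd * Gcd * Gbf))).
  by ring.
rewrite rbc rbd rcd ee.
transitivity (- (N`!%:R * a * r1 * s * xe * ga * (xb * xc * xd * sk * gb * gc * gd * gff)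
  * (eps * eps))); last by ring.
by rewrite ee; ring.
Qed.

(** Dougall's theorem is applied at length [M]. The factor of index [N - M - 1] in
    [rising (1 + a - e) N] is now [a + N] itself. Each of the three reflections has sign
    [(-1) ^ (N + 1)], so the total sign agrees with that of [closed_form_N] and one function can
    interpolate all five values. *)
Lemma closed_form_M : congp f (- N%:Z) -> e = - M%:R ->
  wellpoised a [:: a; b; c; d; f; e] N * GammaT =
  (-1) ^+ N.+1 * (a + N%:R) *
  (a * N`!%:R * (rising (1 + a - b) N * rising (1 + a - c) N *
    rising (1 + a - d) N * rising (1 + a - f) N *
    rising_skip (1 + a - e) (N - M.+1) N)) * GammaL.
Proof.
move=> hf he; have MN' := ltnW MN.
have fE : f = 1 + a *+ 2 - b - c - d + M%:R by rewrite bal he; ring.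
have nz j : (0 < j <= M)%N -> f - j%:R != 0.
  move=> jN; have := congpD hf (congpN (congp_nat j)).
  by move/congp_unit => fu; apply: contraTneq (fu _ _) => [->||]; rewrite ?unitr0 //; lia.
rewrite (wellpoised_cut _ MN'); last by rewrite he !inE eqxx !orbT.
have := dougall fE nz; rewrite -he => ->.
rewrite !big_cons big_nil mulr1.
have g0 : G (1 + a - e) = (-1) ^+ M * rising (1 + a) M * G (1 + a).
  rewrite he opprK padic_Gamma_rising // => j jN.
  by apply: unitD (congpD one ha) _ _; lia.
have refl x y z : congp x (- N%:Z) -> congp y (- N%:Z) -> congp z (- N%:Z) ->
    1 + a - z - f = 1 - (1 + a - x - y - e) ->
    rising (1 + a - x - y) M * G (1 + a - x - y) * G (1 + a - z - f) = (-1) ^+ N.+1.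
  move=> hx hy hz ez.
  have := Gamma2 hx hy MN'; rewrite M_even mul1r => <-.
  have -> : 1 + a - x - y + M%:R = 1 - (1 + a - z - f) by rewrite ez he; ring.
  by rewrite mulrC (congp_reflect (h2 hz hf)) //; lia.
have rbc := refl _ _ _ hb hc hd; have rbd := refl _ _ _ hb hd hc.
have rcd := refl _ _ _ hc hd hb.
have gx x : congp x (- N%:Z) ->
    G (1 + a - x - e) = rising (1 + a - x) M * G (1 + a - x).
  by move=> hx; rewrite he opprK Gamma1 // M_even mul1r.
have cat (x : Zp) : rising x N = rising x M * rising (x + M%:R) (N - M).
  by rewrite -rising_cat subnKC.
have ra : rising a M.*2.+1 * rising (1 + a - e + M%:R) (N - M) =
    a * rising (1 + a) M * ((a + N%:R) * rising_skip (1 + a - e) (N - M.+1) N).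
  have -> : (M.*2.+1 = M.+1 + M)%N by rewrite -addnn.
  have <- : 1 + a - e + (N - M.+1)%:R = a + N%:R.
    by rewrite he natrB // -natr1; ring.
  rewrite -rising_skipE; last by lia.
  rewrite rising_cat risingSl (addrC a 1) cat he opprK -!mulrA; do 3!congr (_ * _).
  by rewrite -natr1; congr rising; ring.
have fa : M`!%:R * rising (1 + a - a + M%:R) (N - M) = N`!%:R :> Zp.
  by rewrite -!rising1 (cat 1) addrK.
rewrite M_even mul1r /GammaT /GammaL (gx _ hb) (gx _ hc) (gx _ hd) (gx _ hf) g0 M_even mul1r -fa !cat.
move: rbc rbd rcd; set s := a + N%:R in ra *; set kap := (-1) ^+ N.+1.
have ee : kap * kap = 1 by rewrite -expr2 sqrr_sign.
set r1 := rising (1 + a) _ in ra *.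
have -> : 1 + a - d - f = 1 - (1 + a - b - c - e).
  by rewrite -[e](addKr (b + c + d + f)) -bal; ring.
have -> : 1 + a - c - f = 1 - (1 + a - b - d - e).
  by rewrite -[e](addKr (b + c + d + f)) -bal; ring.
have -> : 1 + a - b - f = 1 - (1 + a - c - d - e).
  by rewrite -[e](addKr (b + c + d + f)) -bal; ring.
move=> /(_ erefl) rbc /(_ erefl) rbd /(_ erefl) rcd.
move: rbc rbd rcd.
set xbc := rising (1 + a - b - c) M; set xbd := rising (1 + a - b - d) M.
set xcd := rising (1 + a - c - d) M.
set Gbc := G (1 + a - b - c); set Gbd := G (1 + a - b - d).
set Gcd := G (1 + a - c - d).
set Gdf := G (1 - _); set Gcf := G (1 - _); set Gbf := G (1 - _).
move=> rbc rbd rcd.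
set ga := G (1 + a); set gb := G (1 + a - b); set gc := G (1 + a - c).
set gd := G (1 + a - d); set gff := G (1 + a - f).
set xb := rising (1 + a - b) M; set xc := rising (1 + a - c) M.
set xd := rising (1 + a - d) M; set xf := rising (1 + a - f) M.
set yb := rising (1 + a - b + M%:R) _; set yc := rising (1 + a - c + M%:R) _.
set yd := rising (1 + a - d + M%:R) _; set yf := rising (1 + a - f + M%:R) _.
set ya := rising (1 + a - a + M%:R) _.
move: ra; set ye := rising (1 + a - e + M%:R) _; set sk := rising_skip _ _ _.
set r2 := rising a _ => ra.
transitivity (M`!%:R * ya * (r2 * ye) * ga * (xb * xc * xd * xf * yb * yc * yd * yf *
   gb * gc * gd * gff) * ((xbc * Gbc * Gdf) * (xbd * Gbd * Gcf) * (xcd * Gcd * Gbf))).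
  by ring.
rewrite rbc rbd rcd ra ee.
by ring.
Qed.

End ClosedForm.
End Deformation.

Lemma smooth_rising (R : comUnitRingType) (q : R) n (x : nat -> R) k :
  smooth q n x -> smooth q n (fun u => rising (x u) k).
Proof.
move=> sx; apply: (smooth_prod _ (F := fun i u => x u + i%:R)) => i.
exact: smoothD sx (smooth_const _ _ _).
Qed.

(** * Interpolation along the line of parameters *)

Section Interpolation.
Variables (p : nat) (p_pr : prime p) (p_odd : odd p) (p_ge7 : (7 <= p)%N).
Local Notation Zp := (padic_int p_pr).
Local Notation G := (@padic_Gamma p p_pr).
Variables (N M : nat).
Hypotheses (pNM : p = (N.*2 + M).+1) (M_gt0 : (0 < M)%N) (MN : (M < N)%N).

Definition gamma_den (a b c d f e : Zp) := G (1 + a) *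
  (G (1 + a - b - c) * G (1 + a - b - d) * G (1 + a - c - d) *
   G (1 + a - b - f) * G (1 + a - c - f) * G (1 + a - d - f) *
   G (1 + a - b - e) * G (1 + a - c - e) * G (1 + a - d - e) * G (1 + a - f - e)).

Definition gamma_num (a b c d f e : Zp) :=
  G (1 + a - b) * G (1 + a - c) * G (1 + a - d) * G (1 + a - f) * G (1 + a - e).

(* [a * \prod_g rising (1 + a - g) N] without the factor of [rising (1 + a - f) N]
   that is divisible by [p]. *)
Definition rising_den (a b c d f e : Zp) :=
  a * N`!%:R * (rising (1 + a - b) N * rising (1 + a - c) N *
    rising (1 + a - d) N * rising (1 + a - e) N *
    rising_skip (1 + a - f) (N - M.+1) N).

Let sw (a x y : Zp) : G (1 + a - x - y) = G (1 + a - y - x).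
Proof. by rewrite addrAC. Qed.

(** These transpositions carry whichever parameter terminates the sum to the last place, where the
    closed forms expect it. *)
Lemma gamma_den_swap_bc a b c d f e :
  gamma_den a b c d f e = gamma_den a c b d f e.
Proof. by rewrite /gamma_den (sw a c b); ring. Qed.

Lemma gamma_den_swap_cd a b c d f e :
  gamma_den a b c d f e = gamma_den a b d c f e.
Proof. by rewrite /gamma_den (sw a d c); ring. Qed.

Lemma gamma_den_swap_de a b c d f e :
  gamma_den a b c d f e = gamma_den a b c e f d.
Proof. by rewrite /gamma_den (sw a e d) (sw a e f) (sw a f d); ring. Qed.

Lemma gamma_den_swap_ef a b c d f e :
  gamma_den a b c d f e = gamma_den a b c d e f.
Proof. by rewrite /gamma_den (sw a e f); ring. Qed.

Lemma gamma_den_unit a b c d f e : gamma_den a b c d f e \is a GRing.unit.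
Proof. by rewrite !unitrM !padic_Gamma_unit. Qed.

Lemma rising_den_unit a b c d f e :
  congp a (- N%:Z) -> congp b (- N%:Z) -> congp c (- N%:Z) ->
  congp d (- N%:Z) -> congp f (- M%:Z) -> congp e (- N%:Z) ->
  rising_den a b c d f e \is a GRing.unit.
Proof.
move=> ha hb hc hd hf he.
have one : congp (1 : Zp) 1 by exact: (congp_nat p_pr 1).
have unitD x (k : int) j : congp (x : Zp) k -> k + j%:Z != 0 ->
    (`|(k + j%:Z)%R| < p)%N -> x + j%:R \is a GRing.unit.
  by move=> hx; apply/congp_unit/congpD/congp_nat.
have u x : congp x (- N%:Z) -> rising (1 + a - x) N \is a GRing.unit.
  move=> hx; apply: rising_unit => j jN.
  by apply: unitD (congpD (congpD one ha) (congpN hx)) _ _; lia.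
rewrite /rising_den /rising_skip !unitrM !u // -rising1.
rewrite (congp_unit ha) ?(oppr_eq0, abszN) //; [|lia|lia].
have hx := congpD (congpD one ha) (congpN hf).
rewrite !andbT /=; apply/and3P; split; apply: rising_unit => j jN.
- by apply: unitD one _ _; lia.
- by apply: unitD hx _ _; lia.
- by rewrite -addrA -natrD; apply: unitD hx _ _; lia.
Qed.

Variables (alpha w : Zp).
Hypotheses (alphaN : alpha + N%:R = p%:R * alpha) (w120 : 120 * w = 1).
(** Up to the factor [p / 120] this is [a + N] at [u = i], which has to be cancelled there. *)
Hypothesis alpha_neq : forall i, (0 < i <= 5)%N ->
  120 * alpha - i%:R * (101 * alpha + 12) != 0.

(* The deformed parameters as functions of [z = p u], with [w = 1 / 120]:
   [B c] equals [- N] at [u = 120 / c], and [F] equals [- M] at [u = 5]. *)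
Let A : {poly Zp} := alpha%:P - (w * (101 * alpha + 12))%:P * 'X.
Let B (c : nat) : {poly Zp} := alpha%:P - (c%:R * w * alpha)%:P * 'X.
Let F : {poly Zp} := (1 - 2 * alpha)%:P - (24 * w * (1 - 2 * alpha))%:P * 'X.

Let AE z : A.[z] = alpha - w * (101 * alpha + 12) * z.
Proof. by rewrite hornerD hornerN hornerM !hornerC hornerX. Qed.
Let BE c z : (B c).[z] = alpha - c%:R * w * alpha * z.
Proof. by rewrite hornerD hornerN hornerM !hornerC hornerX. Qed.
Let FE z : F.[z] = 1 - 2 * alpha - 24 * w * (1 - 2 * alpha) * z.
Proof. by rewrite hornerD hornerN hornerM !hornerC hornerX. Qed.

Let alphaE : alpha = p%:R * alpha - N%:R.
Proof. by rewrite -alphaN addrK. Qed.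

Let pE : p%:R = N%:R *+ 2 + M%:R + 1 :> Zp.
Proof.
transitivity ((N.*2 + M).+1%:R : Zp); first by rewrite -pNM.
by rewrite -natr1 natrD -addnn natrD mulr2n.
Qed.

Let A_congp u : congp A.[p%:R * u] (- N%:Z).
Proof.
exists (alpha - w * (101 * alpha + 12) * u).
by rewrite AE mulrNz {1}alphaE; ring.
Qed.

Let B_congp c u : congp (B c).[p%:R * u] (- N%:Z).
Proof.
exists (alpha - c%:R * w * alpha * u).
by rewrite BE mulrNz {1}alphaE; ring.
Qed.

Let F_congp u : congp F.[p%:R * u] (- M%:Z).
Proof.
exists (1 - 2 * alpha - 24 * w * (1 - 2 * alpha) * u).
rewrite FE mulrNz {1}alphaE; transitivity (1 + N%:R *+ 2 - p%:R + p%:R * (1 - 2 * alpha - 24 * w * (1 - 2 * alpha) * u)).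
  by ring.
by congr (_ + _); rewrite pE; ring.
Qed.

Let B_at c i : (c * i = 120)%N -> (B c).[p%:R * i%:R] = - N%:R.
Proof.
move=> ci; rewrite BE {1}alphaE.
transitivity (p%:R * alpha * (1 - (c%:R * i%:R) * w) - N%:R); first by ring.
by rewrite -natrM ci w120; ring.
Qed.

Let F_at : F.[p%:R * 5] = - M%:R.
Proof.
rewrite FE; transitivity (1 - 2 * alpha - 120 * w * (p%:R - 2 * (p%:R * alpha))); first by ring.
by rewrite w120 -alphaN pE; ring.
Qed.

(** The origin of 101 and 12: the slopes on the right add up, up to the sign, to [w] times [(120 +
    60 + 40 + 30) alpha + 24 (1 - 2 alpha)], which is [2 (101 alpha + 12)]. *)
Let balanced z : 1 + A.[z] *+ 2 =
  (B 120).[z] + (B 60).[z] + (B 40).[z] + F.[z] + (B 30).[z].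
Proof. by rewrite AE !BE FE; ring. Qed.

Let at_u (X : Zp -> Zp -> Zp -> Zp -> Zp -> Zp -> Zp) u : Zp :=
  let z := p%:R * u%:R in
  X A.[z] (B 120).[z] (B 60).[z] (B 40).[z] F.[z] (B 30).[z].

Let W := at_u (fun a b c d f e => wellpoised a [:: a; b; c; d; f; e] N).

Let closed_form i : (0 < i <= 5)%N ->
  W i * at_u gamma_den i =
  (-1) ^+ N.+1 * (A.[p%:R * i%:R] + N%:R) * at_u rising_den i * at_u gamma_num i.
Proof.
move=> i5; rewrite /W /at_u /=; set z := p%:R * i%:R.
have hA := A_congp i%:R; have hB c := B_congp c i%:R; have hF := F_congp i%:R.
rewrite -/z in hA hF hB; have := balanced z.
have := @B_at 120 i; have := @B_at 60 i; have := @B_at 40 i; have := @B_at 30 i.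
have hF5 : i = 5%N -> F.[z] = - M%:R by move=> i_5; rewrite /z i_5 F_at.
rewrite -/z; move: (hB 120) (hB 60) (hB 40) (hB 30) hA hF hF5 => {hB}.
move: A.[z] (B 120).[z] (B 60).[z] (B 40).[z] F.[z] (B 30).[z].
move=> a b c d f e hb hc hd he ha hf f5 e4 d3 c2 b1 bal.
have CN := @closed_form_N p p_pr p_odd p_ge7 N M pNM M_gt0 MN.
have CM := @closed_form_M p p_pr p_odd p_ge7 N M pNM M_gt0 MN.
case: i i5 {z} f5 e4 d3 c2 b1 => [|[|[|[|[|[|i]]]]]] // _ f5 e4 d3 c2 b1.
- rewrite gamma_den_swap_bc gamma_den_swap_cd gamma_den_swap_de.
  rewrite (@wellpoised_perm _ _ _ [:: a; c; d; e; f; b]); last by apply/permP => P /=; lia.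
  apply: etrans (CN a c d e f b _ ha hc hd he hf (b1 erefl)) _.
    by rewrite bal; ring.
  by rewrite /rising_den /gamma_num; ring.
- rewrite gamma_den_swap_cd gamma_den_swap_de.
  rewrite (@wellpoised_perm _ _ _ [:: a; b; d; e; f; c]); last by apply/permP => P /=; lia.
  apply: etrans (CN a b d e f c _ ha hb hd he hf (c2 erefl)) _.
    by rewrite bal; ring.
  by rewrite /rising_den /gamma_num; ring.
- rewrite gamma_den_swap_de.
  rewrite (@wellpoised_perm _ _ _ [:: a; b; c; e; f; d]); last by apply/permP => P /=; lia.
  apply: etrans (CN a b c e f d _ ha hb hc he hf (d3 erefl)) _.
    by rewrite bal; ring.
  by rewrite /rising_den /gamma_num; ring.
- exact: (CN a b c d f e bal ha hb hc hd hf (e4 erefl)).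
- rewrite gamma_den_swap_ef.
  rewrite (@wellpoised_perm _ _ _ [:: a; b; c; d; e; f]); last by apply/permP => P /=; lia.
  apply: etrans (CM a b c d e f _ ha hb hc hd he (f5 erefl)) _.
    by rewrite bal; ring.
  by rewrite /rising_den /gamma_num; ring.
Qed.

Let smooth_lin_fun c0 c1 (x : nat -> Zp) :
  (forall u, x u = c0 + p%:R * (c1 * u%:R)) -> smooth p%:R 5 x.
Proof.
move=> xE; apply: (@eq_smooth _ _ _ (fun u => c0 + p%:R * (c1 * u%:R))) => //.
by apply: smoothD; [apply: smooth_const | apply: smooth_lin].
Qed.

Let smooth_gamma_lin c0 c1 (x : nat -> Zp) :
  (forall u, x u = c0 + p%:R * (c1 * u%:R)) -> smooth p%:R 5 (fun u => G (x u)).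
Proof.
move=> xE; apply: (@eq_smooth _ _ _ (fun u => G (c0 + p%:R * (c1 * u%:R)))).
  by move=> u; rewrite xE.
exact: smooth_padic_Gamma.
Qed.

Let a1 := - (w * (101 * alpha + 12)).
Let b1 c := - (c%:R * w * alpha).
Let f1 := - (24 * w * (1 - 2 * alpha)).

Let Alin u : A.[p%:R * u%:R] = alpha + p%:R * (a1 * u%:R).
Proof. by rewrite AE /a1; ring. Qed.
Let Blin c u : (B c).[p%:R * u%:R] = alpha + p%:R * (b1 c * u%:R).
Proof. by rewrite BE /b1; ring. Qed.
Let Flin u : F.[p%:R * u%:R] = 1 - 2 * alpha + p%:R * (f1 * u%:R).
Proof. by rewrite FE /f1; ring. Qed.

Let smooth_den : smooth p%:R 5 (at_u gamma_den).
Proof.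
have s1 c0 c1 (x : nat -> Zp) : (forall u, x u = c0 + p%:R * (c1 * u%:R)) ->
    smooth p%:R 5 (fun u => G (1 + A.[p%:R * u%:R] - x u)).
  move=> xE; apply: (smooth_gamma_lin (c0 := 1 + alpha - c0) (c1 := a1 - c1)) => u.
  by rewrite Alin xE; ring.
have s2 c0 c1 c2 c3 (x y : nat -> Zp) : (forall u, x u = c0 + p%:R * (c1 * u%:R)) ->
    (forall u, y u = c2 + p%:R * (c3 * u%:R)) ->
    smooth p%:R 5 (fun u => G (1 + A.[p%:R * u%:R] - x u - y u)).
  move=> xE yE; apply: (smooth_gamma_lin (c0 := 1 + alpha - c0 - c2) (c1 := a1 - c1 - c3)) => u.
  by rewrite Alin xE yE; ring.
have s0 : smooth p%:R 5 (fun u => G (1 + A.[p%:R * u%:R])).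
  by apply: (smooth_gamma_lin (c0 := 1 + alpha) (c1 := a1)) => u; rewrite Alin; ring.
have sBB c c' := s2 _ _ _ _ _ _ (Blin c) (Blin c').
have sBF c := s2 _ _ _ _ _ _ (Blin c) Flin.
have sFB c := s2 _ _ _ _ _ _ Flin (Blin c).
rewrite /at_u /gamma_den; apply: smoothM; first exact: s0.
by do 9!(apply: smoothM; last by auto); auto.
Qed.

Let smooth_num : smooth p%:R 5 (at_u gamma_num).
Proof.
have s1 c0 c1 (x : nat -> Zp) : (forall u, x u = c0 + p%:R * (c1 * u%:R)) ->
    smooth p%:R 5 (fun u => G (1 + A.[p%:R * u%:R] - x u)).
  move=> xE; apply: (smooth_gamma_lin (c0 := 1 + alpha - c0) (c1 := a1 - c1)) => u.
  by rewrite Alin xE; ring.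
have sB c := s1 _ _ _ (Blin c); have sF := s1 _ _ _ Flin.
by rewrite /at_u /gamma_num; do 4!(apply: smoothM; last by auto); auto.
Qed.

Let smooth_rising_den : smooth p%:R 5 (at_u rising_den).
Proof.
have s1 c0 c1 k (x : nat -> Zp) m : (forall u, x u = c0 + p%:R * (c1 * u%:R)) ->
    smooth p%:R 5 (fun u => rising (1 + A.[p%:R * u%:R] - x u + m) k).
  move=> xE; apply: smooth_rising.
  apply: (smooth_lin_fun (c0 := 1 + alpha - c0 + m) (c1 := a1 - c1)) => u.
  by rewrite Alin xE; ring.
have s1' c0 c1 k (x : nat -> Zp) : (forall u, x u = c0 + p%:R * (c1 * u%:R)) ->
    smooth p%:R 5 (fun u => rising (1 + A.[p%:R * u%:R] - x u) k).
  move=> xE; apply: eq_smooth (s1 _ _ k _ 0 xE) => u; by rewrite addr0.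
have sA := smooth_lin_fun Alin.
rewrite /at_u /rising_den /rising_skip; apply: smoothM.
  by apply: smoothM => //; apply: smooth_const.
apply: smoothM; first by do 3!(apply: smoothM; last exact: s1' (Blin _)); exact: s1' (Blin _).
by apply: smoothM; [apply: s1' Flin | apply: s1 Flin].
Qed.

Let p_neq0 : p%:R != 0 :> Zp.
Proof. by rewrite padic_int_natr_eq0 -lt0n prime_gt0. Qed.

(** The factor [p alpha], which is [a + N] at [u = 0], stays outside [Q], so that the later division
    by [p] does not weaken the congruence. *)
Lemma wellpoised_modp5 : exists Q y : Zp,
  wellpoised alpha [:: alpha; alpha; alpha; alpha; 1 - 2 * alpha; alpha] N =
    p%:R * alpha * rising_den alpha alpha alpha alpha (1 - 2 * alpha) alpha * Q /\
  Q = (-1) ^+ N.+1 * gamma_num alpha alpha alpha alpha (1 - 2 * alpha) alpha /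
    gamma_den alpha alpha alpha alpha (1 - 2 * alpha) alpha + p%:R ^+ 5 * y.
Proof.
(* Antisymmetry is used over [{poly Zp}], so that the quotient by [A + N] is a polynomial in [p u]
   and hence smooth. *)
have [Z HZ] : exists Z : {poly Zp},
    wellpoised A [:: A; B 120; B 60; B 40; F; B 30] N *+ 2 = (A + N%:R) * Z.
  by rewrite -{1 2}[A](addrK N%:R); apply: wellpoised_dvd.
have WZ u : W u *+ 2 = (A.[p%:R * u%:R] + N%:R) * Z.[p%:R * u%:R].
  have := congr1 (horner_eval (p%:R * u%:R)) HZ.
  rewrite rmorphMn rmorphM rmorphD rmorph_nat /= rmorph_wellpoised /=.
  by rewrite !horner_evalE.
have Du u : at_u rising_den u \is a GRing.unit.
  by apply: rising_den_unit; rewrite ?B_congp // ?A_congp // F_congp.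
have Tu u : at_u gamma_den u \is a GRing.unit by apply: gamma_den_unit.
(* Here [60 * w] is one half, undoing the doubling in [wellpoised_dvd]. *)
pose Q u := 60 * w * Z.[p%:R * u%:R] / at_u rising_den u.
pose R u := (-1) ^+ N.+1 * at_u gamma_num u / at_u gamma_den u.
have sQR : smooth p%:R 5 (fun u => Q u + -1 * R u).
  apply: smoothD; first apply: smoothM.
  - by apply: smoothM; [apply: smooth_const | apply: smooth_horner].
  - exact: smoothV.
  apply: smoothM; first exact: smooth_const.
  apply: smoothM; first by apply: smoothM => //; apply: smooth_const.
  exact: smoothV.
have WQ u : W u = (A.[p%:R * u%:R] + N%:R) * at_u rising_den u * Q u.
  rewrite /Q -mulrA [at_u rising_den u * _]mulrC divrK //.
  transitivity (60 * w * (W u *+ 2)); last by rewrite WZ; ring.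
  by transitivity (120 * w * W u); [rewrite w120 mul1r | ring].
have A_neq i : (0 < i <= 5)%N -> A.[p%:R * i%:R] + N%:R != 0.
  move=> i5; have : p%:R * (120 * alpha - i%:R * (101 * alpha + 12)) != 0.
    by rewrite mulf_neq0 // alpha_neq.
  apply: contra_neq => s0; have : 120 * (A.[p%:R * i%:R] + N%:R) = 0 by rewrite s0 mulr0.
  rewrite AE.
  have -> : 120 * (alpha - w * (101 * alpha + 12) * (p%:R * i%:R) + N%:R) =
    120 * (alpha + N%:R) - 120 * w * ((101 * alpha + 12) * (p%:R * i%:R)) by ring.
  by rewrite w120 alphaN => <-; ring.
have QR i : (0 < i <= 5)%N -> Q i + -1 * R i = 0.
  move=> i5; rewrite mulN1r; apply/eqP; rewrite subr_eq0; apply/eqP.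
  have E : Q i * at_u gamma_den i = (-1) ^+ N.+1 * at_u gamma_num i.
    apply: (mulrI (Du i)); apply: (mulfI (A_neq i i5)).
    transitivity (W i * at_u gamma_den i); first by rewrite WQ !mulrA.
    rewrite closed_form //; move: (_ ^+ _) (_ + _) (at_u _ _) (at_u _ _) => x y z t.
    by ring.
  by apply: (mulIr (Tu i)); rewrite E /R divrK.
have [y Qy] := smooth_vanish p_neq0 sQR QR.
have A0 : A.[p%:R * 0%:R] = alpha by rewrite AE; ring.
have B0 c : (B c).[p%:R * 0%:R] = alpha by rewrite BE; ring.
have F0 : F.[p%:R * 0%:R] = 1 - 2 * alpha by rewrite FE; ring.
exists (Q 0%N), y; split.
  by have := WQ 0%N; rewrite /W /at_u !A0 !B0 F0 alphaN.
rewrite -Qy -[LHS](addrK (- R 0%N)) mulN1r opprK addrC; congr (_ + _).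
by rewrite /R /at_u !A0 !B0 F0.
Qed.

End Interpolation.

(** * Transfer to the rational series *)

(** [ratr] uses the reduced fraction; its denominator divides [e] and is therefore a unit as
    well. *)
Lemma ratr_div (R : comUnitRingType) (n e : int) : e != 0 ->
  (e%:~R : R) \is a GRing.unit ->
  ratr (n%:~R / e%:~R) = n%:~R / e%:~R :> R.
Proof.
move=> e0 eu; set x : rat := n%:~R / e%:~R.
have xE : numq x * e = n * denq x.
  apply: (@intr_inj rat); rewrite !intrM numqE /x mulrAC divfK //.
  by rewrite intr_eq0.
have [k ek] : exists k, e = k * denq x.
  apply/dvdzP; rewrite -(Gauss_dvdzr (m := denq x) (n := numq x)).
    by rewrite xE dvdz_mull.
  by rewrite coprimezE coprime_sym coprime_num_den.
have du : (denq x)%:~R \is a @GRing.unit R.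
  by move: eu; rewrite {1}ek intrM unitrM => /andP[].
rewrite /ratr; apply: (mulIr du); apply: (mulIr eu).
by rewrite divrK // mulrAC divrK // -!intrM xE.
Qed.

(** * Rational numbers in a field of characteristic 0 *)

Section RatrCharZero.
Variable F : fieldType.
Hypothesis char0 : forall k : nat, ((k%:R : F) == 0) = (k == 0%N).

Let intr_neq0 (k : int) : k != 0 -> (k%:~R : F) != 0.
Proof. by case: k => k; rewrite ?NegzE ?mulrNz ?oppr_eq0 -?[_%:~R]/(_%:R) ?char0. Qed.

Let ratrE (n e : int) : e != 0 -> ratr (n%:~R / e%:~R) = n%:~R / e%:~R :> F.
Proof. by move=> e0; apply: ratr_div => //; rewrite unitfE intr_neq0. Qed.

Lemma ratr_char0M (x y : rat) : ratr (x * y) = ratr x * ratr y :> F.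
Proof.
have xd := denq_neq0 x; have yd := denq_neq0 y.
rewrite -{1}(divq_num_den x) -{1}(divq_num_den y) mulf_div -!intrM.
by rewrite ratrE ?mulf_neq0 // !intrM -mulf_div.
Qed.

Lemma ratr_char0D (x y : rat) : ratr (x + y) = ratr x + ratr y :> F.
Proof.
have xd := denq_neq0 x; have yd := denq_neq0 y.
rewrite -{1}(divq_num_den x) -{1}(divq_num_den y) addf_div ?intr_eq0 //.
rewrite -!intrM -intrD ratrE ?mulf_neq0 // !(intrM, intrD) -addf_div ?intr_neq0 //.
Qed.

Lemma ratr_char0_nat (k : nat) : ratr k%:R = k%:R :> F.
Proof. by have := @ratrE k 1 isT; rewrite !divr1. Qed.

Lemma ratr_char0N (x : rat) : ratr (- x) = - ratr x :> F.
Proof.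
apply/eqP; rewrite -subr_eq0 opprK -ratr_char0D addNr; apply/eqP; exact: (ratr_char0_nat 0).
Qed.

Lemma ratr_char0V (x : rat) : x != 0 -> ratr x^-1 = (ratr x)^-1 :> F.
Proof.
move=> x0; have xx : ratr x * ratr x^-1 = 1 :> F.
  by rewrite -ratr_char0M divff // (ratr_char0_nat 1).
have rx0 : ratr x != 0 :> F.
  by apply/eqP => e; move/eqP: xx; rewrite e mul0r eq_sym oner_eq0.
by apply: (mulfI rx0); rewrite xx divff.
Qed.

Lemma ratr_char0_rising (x : rat) k : ratr (rising x k) = rising (ratr x) k :> F.
Proof.
rewrite /rising (big_morph _ ratr_char0M (ratr_char0_nat 1)).
by apply: eq_bigr => i _; rewrite ratr_char0D ratr_char0_nat.
Qed.

Lemma ratr_char0X (x : rat) k : ratr (x ^+ k) = ratr x ^+ k :> F.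
Proof.
by elim: k => [|k IH]; rewrite ?(ratr_char0_nat 1) // !exprS ratr_char0M IH.
Qed.

Lemma ratr_char0_sum m n (f : nat -> rat) :
  ratr (\sum_(m <= k < n) f k) = \sum_(m <= k < n) ratr (f k) :> F.
Proof. exact: (big_morph _ ratr_char0D (ratr_char0_nat 0)). Qed.

End RatrCharZero.

Lemma frac_eq (F : fieldType) (a b c d : F) : b != 0 -> d != 0 ->
  a * d = c * b -> a / b = c / d.
Proof. by move=> b0 d0 e; apply/eqP; rewrite eqr_div // e. Qed.

Lemma rising_gt0 (x : rat) k : 0 < x -> 0 < rising x k.
Proof.
by move=> x0; apply: prodr_gt0 => i _; apply: ltr_wpDr; rewrite ?ler0n.
Qed.

(* The very-well-poised factor [(1 + a/2)_k / (a/2)_k] equals [(a + 2 k) / a]. *)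
Lemma very_well_poised_term (a : rat) k : 0 < a ->
  (rising a k ^+ 5 * rising (1 + 1 / 2 * a) k * rising (1 - 2 * a) k)
    / ((k`!)%:R ^+ 5 * rising (1 / 2 * a) k * rising (3 * a) k) =
  ((a + 2 * k%:R) * rising a k ^+ 5 * rising (1 - 2 * a) k)
    / (a * (k`!)%:R ^+ 5 * rising (3 * a) k).
Proof.
move=> a0; have h0 : 0 < 1 / 2 * a by rewrite mulr_gt0.
have H : rising (1 + 1 / 2 * a) k * (1 / 2 * a) = rising (1 / 2 * a) k * (1 / 2 * a + k%:R).
  by rewrite addrC mulrC -risingSl risingS.
have nz x : 0 < x -> x != 0 :> rat by move=> /lt0r_neq0.
have f0 : (k`!%:R : rat) != 0 by rewrite pnatr_eq0 -lt0n fact_gt0.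
have r1 := nz _ (rising_gt0 k h0).
have r2 : rising (3 * a) k != 0 by apply/nz/rising_gt0; rewrite mulr_gt0.
have a1 := nz _ a0.
apply: frac_eq; rewrite ?mulf_neq0 ?expf_neq0 //.
move: H r1; set x := rising _ _; set y := rising (1 / 2 * a) k => H _.
set t := rising a k; set u := rising (1 - _) k; set v := rising (3 * a) k.
set f := _%:R ^+ 5.
transitivity (2 * t ^+ 5 * u * f * v * (x * (1 / 2 * a))); first by field.
by rewrite H; field.
Qed.


(** * The series over [Q_p]: head, tail and value at [u = 0] *)

Section Transfer.
Variables (p : nat) (p_pr : prime p) (p_odd : odd p) (p_ge7 : (7 <= p)%N).
Local Notation Zp := (padic_int p_pr).
Local Notation K := (padic p_pr).
Local Notation G := (@padic_Gamma p p_pr).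
Variables (N M : nat).
Hypotheses (pNM : p = (N.*2 + M).+1) (M_gt0 : (0 < M)%N) (MN : (M < N)%N).
Variable alpha : Zp.
Hypotheses (alphaN : alpha + N%:R = p%:R * alpha)
  (alpha3 : 3 * alpha - 1 \is a GRing.unit).

Let io : {rmorphism Zp -> K} := @FracField.tofrac Zp.

Let io_neq0 x : (io x != 0) = (x != 0).
Proof. by rewrite tofrac_eq0. Qed.

Let num k := (alpha + 2 * k%:R) * rising alpha k ^+ 5 * rising (1 - 2 * alpha) k.
Let den k := alpha * (k`!)%:R ^+ 5 * rising (3 * alpha) k.

Let p_neq0 : p%:R != 0 :> Zp.
Proof. by rewrite padic_int_natr_eq0 -lt0n prime_gt0. Qed.

Let alphaE : alpha = p%:R * alpha - N%:R.
Proof. by rewrite -alphaN addrK. Qed.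

Let alpha_congp : congp alpha (- N%:Z).
Proof. by exists alpha; rewrite mulrNz addrC {1}alphaE. Qed.

Let alpha_unit : alpha \is a GRing.unit.
Proof. by apply: (congp_unit alpha_congp); lia. Qed.

Let pE : p%:R = N%:R *+ 2 + M%:R + 1 :> Zp.
Proof.
transitivity ((N.*2 + M).+1%:R : Zp); first by rewrite -pNM.
by rewrite -natr1 natrD -addnn natrD mulr2n.
Qed.

(** Since [N - M - 1 = 3 N - p], this is three times [alpha + N = p alpha], less [p]. It is the only
    multiple of [p] among the first [p] factors, and the source of [3 alpha - 1] in the final
    formula. *)
Let pole : 3 * alpha + (N - M.+1)%:R = p%:R * (3 * alpha - 1).
Proof.
rewrite {1}alphaE natrB // -natr1.
transitivity (p%:R * (3 * alpha) - (N%:R *+ 2 + M%:R + 1)); first by ring.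
by rewrite -pE; ring.
Qed.

Let pole2 : 1 - 2 * alpha + M%:R = p%:R * (1 - 2 * alpha).
Proof.
rewrite {1}alphaE; transitivity (N%:R *+ 2 + M%:R + 1 - p%:R * (2 * alpha)).
  by ring.
by rewrite -pE; ring.
Qed.

Let alpha3_congp : congp (3 * alpha) (- (N - M.+1)%N%:Z).
Proof.
exists (3 * alpha - 1); rewrite -pole mulrNz -[(_ : int)%:~R]/((N - M.+1)%:R).
by ring.
Qed.

Let skip_unit k : (k <= p)%N -> rising_skip (3 * alpha) (N - M.+1) k \is a GRing.unit.
Proof.
move=> kp; rewrite /rising_skip unitrM; apply/andP; split; apply: rising_unit => j jN.
- by apply: congp_unit (congpD alpha3_congp (congp_nat p_pr j)) _ _; lia.
- rewrite -addrA -natrD.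
  by apply: congp_unit (congpD alpha3_congp (congp_nat p_pr _)) _ _; lia.
Qed.

Let fact_unit k : (k < p)%N -> (k`!%:R : Zp) \is a GRing.unit.
Proof.
move=> kp; rewrite -rising1; apply: rising_unit => j jk.
by apply: congp_unit (congpD (congp_nat p_pr 1) (congp_nat p_pr j)) _ _; lia.
Qed.

Let unit_neq0 x : x \is a GRing.unit -> x != 0 :> Zp.
Proof. by apply: contraTneq => ->; rewrite unitr0. Qed.

Let rising3_neq0 k : (k < p)%N -> rising (3 * alpha) k != 0.
Proof.
move=> kp; have : rising (3 * alpha) p != 0.
  rewrite (@rising_skipE _ _ (N - M.+1)) ?pole; last by lia.
  apply: mulf_neq0; last exact/unit_neq0/skip_unit.
  by apply: mulf_neq0; [exact: p_neq0 | exact: unit_neq0].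
have -> : rising (3 * alpha) p = rising (3 * alpha) k * rising (3 * alpha + k%:R) (p - k).
  by rewrite -rising_cat subnKC // ltnW.
by rewrite mulf_eq0 negb_or => /andP[].
Qed.

Let den_neq0 k : (k < p)%N -> den k != 0.
Proof.
move=> kp; apply: mulf_neq0; last exact: rising3_neq0.
apply: mulf_neq0; first exact: unit_neq0.
exact/expf_neq0/unit_neq0/fact_unit.
Qed.

Lemma tail_term k : (N < k < p)%N -> exists z, io (num k) / io (den k) = p%:R ^+ 5 * io z.
Proof.
move=> /andP[Nk kp]; have dk := den_neq0 kp.
pose v := alpha * (k`!)%:R ^+ 5 * (3 * alpha - 1) * rising_skip (3 * alpha) (N - M.+1) k.
have vu : v \is a GRing.unit.
  apply: rpredM; last exact/skip_unit/ltnW.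
  apply: rpredM => //; apply: rpredM; first exact: alpha_unit.
  exact/rpredX/fact_unit.
pose y1 := alpha * rising_skip alpha N k.
pose y2 := (1 - 2 * alpha) * rising_skip (1 - 2 * alpha) M k.
pose z := (alpha + 2 * k%:R) * y1 ^+ 5 * y2 / v.
have dE : den k = p%:R * v.
  by rewrite /den (@rising_skipE _ _ (N - M.+1)) ?pole /v; [ring | lia].
have nE : num k = p%:R ^+ 5 * z * den k.
  rewrite dE; transitivity (p%:R ^+ 6 * (z * v)); last by ring.
  rewrite /z divrK // /num (rising_skipE _ Nk) alphaN.
  by rewrite (@rising_skipE _ _ M) ?pole2 /y1 /y2; [ring | lia].
exists z; rewrite nE rmorphM mulfK ?io_neq0 //.
by rewrite rmorphM rmorphXn rmorph_nat.
Qed.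

Lemma head_sum : \sum_(0 <= k < N.+1) io (num k) / io (den k) =
  io (wellpoised alpha [:: alpha; alpha; alpha; alpha; 1 - 2 * alpha; alpha] N) /
  io (p%:R * (3 * alpha - 1) * rising_den N M alpha alpha alpha alpha (1 - 2 * alpha) alpha).
Proof.
have Np : (N < p)%N by lia.
set D := _ * rising_den _ _ _ _ _ _ _ _.
have alphaC : 1 + alpha - alpha = 1 by rewrite addrK.
have alphaC2 : 1 + alpha - (1 - 2 * alpha) = 3 * alpha by ring.
have DE : D = alpha * N`!%:R ^+ 5 * rising (3 * alpha) N.
  rewrite /D /rising_den alphaC alphaC2 rising1 (@rising_skipE _ (3 * alpha) (N - M.+1)); last by lia.
  by rewrite pole; ring.
have D0 : io D != 0 by rewrite io_neq0 DE; apply: den_neq0.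
rewrite /wellpoised rmorph_sum mulr_suml; apply: eq_big_nat => k /andP[_ kN] /=.
have kp : (k < p)%N by apply: leq_ltn_trans Np.
apply: (frac_eq _ D0); first by rewrite io_neq0 den_neq0.
rewrite -!rmorphM; apply: (congr1 io); rewrite !big_cons big_nil alphaC alphaC2 DE /num /den.
have cat (x : Zp) : rising x N = rising x k * rising (x + k%:R) (N - k).
  by rewrite -rising_cat subnKC.
by rewrite -!rising1 !cat; ring.
Qed.

(** For equal parameters the six pairs without [f] give [G (1 - alpha)] and the four with [f] give
    [G (2 alpha)]. The sixth power removes the sign of the reflection, and
    [G (1 + alpha) = - alpha G alpha] absorbs the outer [alpha]. *)
Lemma gamma_quotient :
  alpha * ((-1) ^+ N.+1 * gamma_num alpha alpha alpha alpha (1 - 2 * alpha) alpha /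
    gamma_den alpha alpha alpha alpha (1 - 2 * alpha) alpha) =
  (-1) ^+ N * (G alpha ^+ 5 * G (3 * alpha)) / G (2 * alpha) ^+ 4.
Proof.
have du := gamma_den_unit p_odd alpha alpha alpha alpha (1 - 2 * alpha) alpha.
have g2 : G (2 * alpha) ^+ 4 \is a GRing.unit by rewrite unitrX // padic_Gamma_unit.
apply: (mulIr du); rewrite -[LHS]mulrA divrK //.
apply: (mulIr g2); rewrite [RHS]mulrAC divrK //.
rewrite /gamma_num /gamma_den addrK padic_Gamma1 //.
have -> : 1 + alpha - (1 - 2 * alpha) = 3 * alpha by ring.
have -> : 1 - (1 - 2 * alpha) = 2 * alpha by ring.
have -> : 3 * alpha - alpha = 2 * alpha by ring.
rewrite (addrC 1 alpha) padic_GammaS_unit //.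
have : G alpha * G (1 - alpha) = (-1) ^+ (N + M.+1).
  apply: congp_reflect => //; last by lia.
  exists (alpha - 1); rewrite -[(_ : int)%:~R]/((N + M.+1)%:R) natrD -natr1.
  transitivity (N%:R + (M%:R + 1) + (p%:R * alpha - (N%:R *+ 2 + M%:R + 1))).
    by rewrite {1}alphaE; ring.
  by rewrite -pE; ring.
move=> E; have {E} : (G alpha * G (1 - alpha)) ^+ 6 = 1.
  by rewrite E -exprM -signr_odd oddM andbF.
move: (G alpha) (G (1 - alpha)) => x y E.
transitivity (- ((-1) ^+ N * alpha * G (3 * alpha) * G (2 * alpha) ^+ 4 * (x * y) ^+ 6)).
  by rewrite E exprS; ring.
by ring.
Qed.

Variable w : Zp.
Hypotheses (w120 : 120 * w = 1)
  (alpha_neq : forall i, (0 < i <= 5)%N ->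
     120 * alpha - i%:R * (101 * alpha + 12) != 0).

Lemma truncated_sum : exists z,
  \sum_(0 <= k < p) io (num k) / io (den k) =
  io ((-1) ^+ N * (G alpha ^+ 5 * G (3 * alpha)) / G (2 * alpha) ^+ 4) /
    io (3 * alpha - 1) + p%:R ^+ 5 * io z.
Proof.
have [Q [y [WE QE]]] := wellpoised_modp5 p_odd p_ge7 pNM M_gt0 MN alphaN w120 alpha_neq.
have [t tE] : exists t, \sum_(N.+1 <= k < p) io (num k) / io (den k) = p%:R ^+ 5 * io t.
  rewrite big_nat; apply: (big_ind (fun x => exists t, x = p%:R ^+ 5 * io t)).
  - by exists 0; rewrite rmorph0 mulr0.
  - by move=> _ _ [t ->] [t' ->]; exists (t + t'); rewrite rmorphD mulrDr.
  - by move=> k /tail_term.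
have s0 : io (3 * alpha - 1) != 0 by rewrite io_neq0 unit_neq0.
set v := alpha * y / (3 * alpha - 1); exists (v + t).
have vt : p%:R ^+ 5 * io (v + t) = p%:R ^+ 5 * io v + p%:R ^+ 5 * io t.
  by rewrite rmorphD mulrDr.
rewrite (@big_cat_nat _ _ _ N.+1) //=; last by lia.
rewrite head_sum WE tE vt addrA; congr (_ + _).
set rd := rising_den _ _ _ _ _ _ _ _.
(* The [p] of [a + N] cancels the [p] of [pole], leaving the unit [3 alpha - 1] below. *)
have -> : io (p%:R * alpha * rd * Q) / io (p%:R * (3 * alpha - 1) * rd) =
    io (alpha * Q) / io (3 * alpha - 1).
  have rdu : rd \is a GRing.unit.
    have c2 : congp (1 - 2 * alpha) (- M%:Z).
      by exists (1 - 2 * alpha); rewrite -pole2 mulrNz -[(_ : int)%:~R]/(M%:R); ring.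
    exact: rising_den_unit.
  apply: frac_eq s0 _.
    rewrite io_neq0; apply: mulf_neq0; last exact: unit_neq0.
    by apply: mulf_neq0; [exact: p_neq0 | exact: unit_neq0].
  by rewrite -!rmorphM; apply: (congr1 io); ring.
rewrite QE mulrDr gamma_quotient rmorphD mulrDl; congr (_ + _).
apply: (mulIf s0); rewrite divfK //.
have vE : io v * io (3 * alpha - 1) = io (alpha * y) by rewrite -rmorphM /v divrK.
rewrite -[RHS]mulrA vE -(rmorph_nat io) -rmorphXn -rmorphM.
by apply: (congr1 io); ring.
Qed.

End Transfer.

Section RatrPadic.
Variables (p : nat) (p_pr : prime p).
Local Notation Zp := (padic_int p_pr).

Lemma ratr_padic_int (n e : nat) : ~~ (p %| e)%N ->
  ratr (n%:R / e%:R) = n%:R / e%:R :> Zp.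
Proof.
move=> pe; have e0 : e%:Z != 0 by apply: contraNneq pe => -[->]; rewrite dvdn0.
by apply: (ratr_div (n%:Z) e0); apply: padic_intr_unit; rewrite prime_coprime.
Qed.

Lemma ratr_padic (n e : nat) : ~~ (p %| e)%N ->
  ratr (n%:R / e%:R) = padic_of_int (n%:R / e%:R) :> padic p_pr.
Proof.
move=> pe; have e0 : e%:Z != 0 by apply: contraNneq pe => -[->]; rewrite dvdn0.
have eu : (e%:R : Zp) \is a GRing.unit.
  by apply: (@padic_intr_unit p p_pr e%:Z); rewrite prime_coprime.
have eK : (e%:R : padic p_pr) != 0 by rewrite padic_natr_eq0.
have -> : ratr (n%:R / e%:R) = n%:R / e%:R :> padic p_pr.
  by apply: (ratr_div (n%:Z) e0); rewrite unitfE.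
apply: (mulIf eK); rewrite divfK // -!(rmorph_nat (@FracField.tofrac Zp)).
by rewrite -rmorphM divrK.
Qed.

End RatrPadic.

Theorem theorem8p1 (d r : nat) (hd : (5 <= d)%N)
    (hr3 : d%:R / 3 < r%:R :> rat) (hr2 : r%:R < d%:R / 2 :> rat)
    (hrd : gcdn r d = 1%N)
    (p : nat) (p_pr : prime p) (hp : p = 1 %[mod d]) :
  let a : rat := r%:R / d%:R in
  let G (x : rat) : padic p_pr :=
    padic_of_int (padic_Gamma (ratr x : padic_int p_pr)) in
  padic_eqmod 5
    (ratr (\sum_(0 <= k < p)
       (rising a k ^+ 5 * rising (1 + 1 / 2 * a) k * rising (1 - 2 * a) k)
       / ((k`!)%:R ^+ 5 * rising (1 / 2 * a) k * rising (3 * a) k)) : padic p_pr)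
    ((-1) ^+ ((p - 1) %/ d) / ratr (3 * a - 1)
       * ((G a ^+ 5 * G (3 * a)) / G (2 * a) ^+ 4)).
Proof.
move=> a G.
have d3r : (d < 3 * r)%N.
  by move: hr3; rewrite ltr_pdivrMr // -natrM ltr_nat mulnC.
have r2d : (2 * r < d)%N.
  by move: hr2; rewrite ltr_pdivlMr // -natrM ltr_nat mulnC.
pose m := ((p - 1) %/ d)%N; have p_gt1 := prime_gt1 p_pr.
have pm : p = (m * d + 1)%N.
  have d1 : (p - 1 = (p - 1) %/ d * d)%N.
    rewrite divnK // -eqn_mod_dvd; last exact: ltnW.
    exact/eqP.
  by rewrite /m -d1 subnK // ltnW.
have m_gt0 : (0 < m)%N by rewrite lt0n; apply: contraTneq p_gt1 => m0; rewrite pm m0.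
have d_lt_p : (d < p)%N by rewrite pm addn1 ltnS leq_pmull.
have p_odd : odd p.
  by apply: contraLR d_lt_p => pe; rewrite -leqNgt (prime_oddPn p_pr pe); lia.
have p_ge7 : (7 <= p)%N.
  by case: (ltngtP p 6) p_odd d_lt_p => [| |->] //; lia.
pose N := (r * m)%N; pose M := (p - 1 - N.*2)%N.
(* The bounds on [r / d] become [2 r + 1 <= d] and [d + 1 <= 3 r]; multiplied by [m], they give
   [0 < M < N]. *)
have N2 : (2 * N + m < p)%N by rewrite /N pm; nia.
have N3 : (p <= 3 * N)%N by rewrite /N pm; nia.
have pNM : p = (N.*2 + M).+1 by rewrite /M -mul2n; lia.
have M_gt0 : (0 < M)%N by rewrite /M -mul2n; lia.
have MN : (M < N)%N by rewrite /M -mul2n; lia.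
have pd : ~~ (p %| d)%N by rewrite gtnNdvd //; lia.
pose Zp := padic_int p_pr.
have [alpha alphaE] : exists alpha : Zp, alpha = r%:R / d%:R by eexists.
have nat_unit (k : nat) : ~~ (p %| k)%N -> (k%:R : Zp) \is a GRing.unit.
  by move=> pk; apply: (@padic_intr_unit p p_pr k%:Z); rewrite prime_coprime.
have du := nat_unit _ pd.
have dalpha : d%:R * alpha = r%:R by rewrite mulrC alphaE divrK.
have alphaN : alpha + N%:R = p%:R * alpha.
  apply: (mulrI du); rewrite mulrDr mulrCA dalpha.
  have E : (r + d * N = p * r)%N by rewrite /N pm; nia.
  by rewrite -!natrM -natrD E.
have alpha3 : 3 * alpha - 1 \is a GRing.unit.
  have : d%:R * (3 * alpha - 1) \is a GRing.unit.
    rewrite mulrBr mulrCA dalpha mulr1 -natrM -natrB 1?ltnW //.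
    by apply: nat_unit; rewrite gtnNdvd //; lia.
  by rewrite unitrM => /andP[].
have u120 : (120 : Zp) \is a GRing.unit.
  apply: nat_unit; rewrite (_ : 120 = 4 * 5 * 6)%N // !Euclid_dvdM //.
  by rewrite !gtnNdvd //; lia.
have w120 : 120 * 120^-1 = 1 :> Zp by rewrite divrr.
(* After multiplication by [d] this concerns integers, and [d > 2 r] gives
   [101 r + 12 d > 125 r]. *)
have alpha_neq i : (0 < i <= 5)%N ->
    120 * alpha - i%:R * (101 * alpha + 12) != 0.
  move=> /andP[i0 _]; apply/eqP => e.
  have i_lt : (120 * r < i * (101 * r + 12 * d))%N.
    by apply: leq_trans (leq_pmull _ i0); lia.
  have : (i * (101 * r + 12 * d) - 120 * r)%:R = 0 :> Zp.
    rewrite natrB; last exact: ltnW.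
    rewrite !(natrM, natrD) -dalpha.
    transitivity (- (d%:R * (120 * alpha - i%:R * (101 * alpha + 12)))); first by ring.
    by rewrite e mulr0 oppr0.
  by move/eqP; rewrite padic_int_natr_eq0 subn_eq0 leqNgt i_lt.
have [z sumE] := truncated_sum p_odd p_ge7 pNM M_gt0 MN alphaN alpha3 w120 alpha_neq.
pose io : {rmorphism Zp -> padic p_pr} := @FracField.tofrac Zp.
have char0 := padic_natr_eq0 p_pr.
have ioM x y : io (x * y) = io x * io y by exact: rmorphM.
have ioD x y : io (x + y) = io x + io y by exact: rmorphD.
have ioX x k : io (x ^+ k) = io x ^+ k by exact: rmorphXn.
have io_nat k : io k%:R = k%:R by exact: rmorph_nat.
have io_rising x k : io (rising x k) = rising (io x) k by exact: rmorph_rising.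
have aK : ratr a = io alpha by rewrite alphaE; apply: ratr_padic.
have GE (c : nat) : G (c%:R * a) = io (padic_Gamma (c%:R * alpha)).
  rewrite /G (_ : c%:R * a = (c * r)%:R / d%:R); last by rewrite natrM mulrA.
  by rewrite ratr_padic_int // natrM -mulrA -alphaE.
have G1 : G a = io (padic_Gamma alpha) by have := GE 1%N; rewrite !mul1r.
have a_gt0 : 0 < a by apply: divr_gt0; rewrite ltr0n; lia.
have rat_io (c : nat) : ratr (c%:R * a) = io (c%:R * alpha).
  by rewrite ratr_char0M // aK ratr_char0_nat // rmorphM rmorph_nat.
have ratr1 : ratr 1 = 1 :> padic p_pr by exact: (ratr_char0_nat char0 1).
have one_io : ratr (1 - 2 * a) = io (1 - 2 * alpha).
  by rewrite ratr_char0D // ratr_char0N // (rat_io 2%N) ratr1 rmorphB rmorph1.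
have term_io k : ratr ((rising a k ^+ 5 * rising (1 + 1 / 2 * a) k * rising (1 - 2 * a) k)
      / ((k`!)%:R ^+ 5 * rising (1 / 2 * a) k * rising (3 * a) k)) =
    io ((alpha + 2 * k%:R) * rising alpha k ^+ 5 * rising (1 - 2 * alpha) k) /
    io (alpha * (k`!)%:R ^+ 5 * rising (3 * alpha) k).
  rewrite very_well_poised_term // (ratr_char0M char0) (ratr_char0V char0); last first.
    apply: lt0r_neq0; apply: mulr_gt0; last by apply: rising_gt0; apply: mulr_gt0.
    by apply: mulr_gt0 => //; apply: exprn_gt0; rewrite ltr0n fact_gt0.
  congr (_ / _).
    rewrite 2!(ratr_char0M char0) (ratr_char0X char0) 2!(ratr_char0_rising char0) one_io aK.
    rewrite (ratr_char0D char0) (ratr_char0M char0) aK 2!(ratr_char0_nat char0).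
    by rewrite [RHS]ioM [X in _ = X * _]ioM ioX 2!io_rising [io (alpha + _)]ioD [io (2 * k%:R)]ioM !io_nat.
  rewrite 2!(ratr_char0M char0) (ratr_char0X char0) (ratr_char0_rising char0) (rat_io 3%N) aK.
  by rewrite (ratr_char0_nat char0) [RHS]ioM [io (alpha * _)]ioM ioX io_rising io_nat.
exists z; rewrite ratr_char0_sum // (eq_bigr _ (fun k _ => term_io k)) sumE.
have den_io : ratr (3 * a - 1) = io (3 * alpha - 1).
  by rewrite (ratr_char0D char0) (rat_io 3%N) (ratr_char0N char0) ratr1 [RHS]ioD rmorphN rmorph1.
(* As [N = r m], the signs agree when [r] is odd. When [r] is even, coprimality makes [d] odd, and
   [p = m d + 1] odd forces [m] even. *)
have -> : (-1) ^+ ((p - 1) %/ d) = io ((-1) ^+ N).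
  rewrite ioX rmorphN rmorph1 -/m -signr_odd -[RHS]signr_odd /N oddM; congr (_ ^+ _).
  case r_odd : (odd r) => //=.
  have : odd p = ~~ odd (m * d) by rewrite pm addn1.
  rewrite p_odd oddM; case d_odd : (odd d); first by rewrite andbT; case: (odd m).
  move=> _.
  have : (2 %| gcdn r d)%N by rewrite dvdn_gcd !dvdn2 r_odd d_odd.
  by rewrite hrd.
rewrite den_io G1 (GE 2%N) (GE 3%N) /padic_of_int -[tofrac z]/(io z).
set g1 := padic_Gamma alpha; set g2 := padic_Gamma (2 * alpha).
set g3 := padic_Gamma (3 * alpha).
have g2u : g2 \is a GRing.unit by apply: padic_Gamma_unit.
have -> : io ((-1) ^+ N * (g1 ^+ 5 * g3) / g2 ^+ 4) =
    io ((-1) ^+ N) * (io g1 ^+ 5 * io g3 / io g2 ^+ 4).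
  have g20 : io g2 ^+ 4 != 0.
    by rewrite expf_neq0 // tofrac_eq0; apply: contraTneq g2u => ->; rewrite unitr0.
  apply: (mulIf g20); rewrite -{1}ioX -ioM divrK ?unitrX //.
  by rewrite -[RHS]mulrA divfK // [LHS]ioM [io (_ * g3)]ioM [io (g1 ^+ 5)]ioX.
by rewrite [X in X + _ - _]mulrAC addrAC subrr add0r.
Qed.
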